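(* Let $R\in\mathcal{R}(d)$ be an R-matrix and $n\in\mathbb{N}$, $n\ge1$. Then $$\mathcal{M}_{R,n}=\mathcal{M}^{\mathrm{ad}\,{}_nR\,\circ\varphi}=\bigoplus_{k=-n+1}^{n-1}(\mathcal{M}^{(k)})^{\mathrm{ad}\,{}_nR\,\circ\varphi},$$ $$\mathcal{M}_{R,n}^{(0)}=\lambda_R^n(\mathcal{M})'\cap\mathcal{N}=(\mathcal{F}_d^n)^{\mathrm{ad}\,{}_nR\,\circ\varphi}=\{x\in\mathcal{F}_d^n:\varphi(x)=\lambda_{R^*}(x)\},$$ and in particular, for $n=1$, $$\mathcal{M}_{R,1}=\mathcal{M}_{R,1}^{(0)}=\{x\in\mathcal{F}_d^1:\varphi(x)=R^*xR\}.$$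
   Context: Let $d\ge 2$. $\mathcal{O}_d$ is the Cuntz algebra generated by isometries $S_1,\dots,S_d$ with $S_i^*S_j=\delta_{ij}1$, $\sum_iS_iS_i^*=1$. $\mathcal{F}_d^n=\mathrm{span}\{S_\mu S_\nu^*:|\mu|=|\nu|=n\}\cong M_d^{\otimes n}$, and $\mathcal{F}_d$ is the norm closure of $\bigcup_n\mathcal{F}_d^n$. A unitary $u\in\mathcal{O}_d$ defines the unital endomorphism $\lambda_u$ of $\mathcal{O}_d$ with $\lambda_u(S_i)=uS_i$. The canonical endomorphism is $\varphi(x)=\sum_iS_ixS_i^*$. An R-matrix of dimension $d$ is a unitary $R$ on $\mathbb{C}^d\otimes\mathbb{C}^d$ with $(R\otimes1)(1\otimes R)(R\otimes1)=(1\otimes R)(R\otimes1)(1\otimes R)$; via $M_d\otimes M_d\cong\mathcal{F}_d^2$ it is a unitary in $\mathcal{F}_d^2$ with $R\varphi(R)R=\varphi(R)R\varphi(R)$. $\mathcal{R}(d)$ is the set of all these. $\tau$ is the normalized trace on $\mathcal{F}_d$, $E^0(x)=\frac1{2\pi}\int_0^{2\pi}\lambda_{e^{it}1}(x)\,dt$, $\omega=\tau\circ E^0$, $\mathcal{M}=\pi_\omega(\mathcal{O}_d)''$, $\mathcal{N}=\pi_\omega(\mathcal{F}_d)''$ ($\pi_\omega$ the faithful GNS representation, suppressed in notation). For unitary $u\in\mathcal{F}_d$, $\lambda_u$ extends to a normal $\omega$-preserving endomorphism of $\mathcal{M}$ leaving $\mathcal{N}$ invariant; also $\varphi$ extends to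 $\mathcal{M}$. For $k\in\mathbb{Z}$, $\mathcal{M}^{(k)}=\{x\in\mathcal{M}:\lambda_{e^{it}1}(x)=e^{itk}x\ \forall t\in\mathbb{R}\}$ is the $k$-th spectral subspace of the gauge action; $\mathcal{M}^{(0)}=\mathcal{N}$. $\mathcal{M}_{R,n}:=\lambda_R^n(\mathcal{M})'\cap\mathcal{M}$ and $\mathcal{M}_{R,n}^{(0)}:=\mathcal{M}_{R,n}\cap\mathcal{M}^{(0)}$. ${}_nR:=\varphi^{n-1}(R)\cdots\varphi(R)R$, $(\mathrm{ad}\,u)(x)=uxu^*$, and $X^{\theta}:=\{x\in X:\theta(x)=x\}$ for a subset $X\subset\mathcal{M}$ and a map $\theta:\mathcal{M}\to\mathcal{M}$. *)

(* Defs.v *)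
From HB Require Import structures.
From mathcomp Require Import all_boot all_order all_algebra.
From mathcomp Require Import all_classical all_reals all_analysis.
From mathcomp Require Import complex mxtens.
Set Implicit Arguments.
Unset Strict Implicit.
Unset Printing Implicit Defensive.
Import Order.TTheory GRing.Theory Num.Theory.
Import numFieldNormedType.Exports.
Local Open Scope classical_set_scope.
Local Open Scope complex_scope.
Local Open Scope ring_scope.

(* Complex Hilbert spaces; the inner product is linear in its second
   argument, and positive definite because it induces the norm. *)
Record hilbertSpace (K : realType) := HilbertSpace {
  hilbert_space :> completeNormedModType K[i] ;
  hdot : hilbert_space -> hilbert_space -> K[i] ;
  hdot_linear : forall (xi : hilbert_space) (a : K[i]) (eta zeta : hilbert_space),
    hdot xi (a *: eta + zeta) = a * hdot xi eta + hdot xi zeta ;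
  hdot_conj : forall xi eta : hilbert_space, hdot eta xi = (hdot xi eta)^* ;
  hdot_norm : forall xi : hilbert_space, hdot xi xi = `|xi| ^+ 2 }.

(* Operators are plain maps H -> H; membership in B(H) is [bounded_op]. *)
Section Operators.
Context {K : realType} {H : hilbertSpace K}.
Implicit Types (x y u : H -> H) (X A M : set (H -> H)).

Definition bounded_op x : Prop := linear x /\ continuous x.

(* For bounded x the set below is a singleton (Riesz). *)
Definition adj x : H -> H := xget (0 : H -> H)
  [set y | bounded_op y /\
     forall xi eta : H, hdot (x xi) eta = hdot xi (y eta)].

Definition unitary_op u : Prop :=
  [/\ bounded_op u, adj u \o u = idfun & u \o adj u = idfun].

Definition Ad u x : H -> H := u \o x \o adj u.

Definition commutant X : set (H -> H) :=
  [set y | bounded_op y /\ forall x, X x -> y \o x = x \o y].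

Definition norm_closure X : set (H -> H) :=
  [set x | bounded_op x /\
     forall e : K, 0 < e -> exists2 y, X y &
       forall xi : H, `|x xi - y xi| <= e%:C * `|xi|].

Definition cstar_subalgebra A : Prop :=
  [/\ A `<=` bounded_op /\ norm_closure A `<=` A,
      A idfun,
      forall (a : K[i]) x y, A x -> A y -> A (a *: x + y),
      forall x y, A x -> A y -> A (x \o y) &
      forall x, A x -> A (adj x)].

Definition cstar_generated X : set (H -> H) :=
  [set x | forall A, cstar_subalgebra A -> X `<=` A -> A x].

(* F(x) = sum_m <xi_m, x eta_m> with square-summable xi and eta: these are
   the functionals inducing the sigma-weak (ultraweak) topology. *)
Definition sigma_weak_functional (F : (H -> H) -> K[i]^o) : Prop :=
  exists xi eta : nat -> H,
    [/\ cvgn (series (fun m => `|xi m| ^+ 2 : K[i]^o)),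
        cvgn (series (fun m => `|eta m| ^+ 2 : K[i]^o)) &
        forall x, bounded_op x ->
          series (fun m => hdot (xi m) (x (eta m)) : K[i]^o) @ \oo --> F x].

(* sigma-weak continuity of a linear map f : M -> M: since f is linear, this
   says that f pulls sigma-weakly continuous functionals back to such. *)
Definition normal_map M (f : (H -> H) -> (H -> H)) : Prop :=
  forall F, sigma_weak_functional F ->
    exists2 G, sigma_weak_functional G &
      forall x, M x -> F (f x) = G x.

Definition star_endomorphism M (f : (H -> H) -> (H -> H)) : Prop :=
  [/\ forall x, M x -> M (f x),
      f idfun = idfun,
      forall (a : K[i]) x y, M x -> M y -> f (a *: x + y) = a *: f x + f y,
      forall x y, M x -> M y -> f (x \o y) = f x \o f y &
      forall x, M x -> f (adj x) = adj (f x)].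

Definition fixed X (theta : (H -> H) -> (H -> H)) : set (H -> H) :=
  [set x | X x /\ theta x = x].

Definition internal_direct_sum (s : seq int) (W : int -> set (H -> H)) X :=
  X = [set x | exists2 w : int -> H -> H,
         forall k, k \in s -> W k (w k) & x = \sum_(k <- s) w k]
  /\ forall w : int -> H -> H, (forall k, k \in s -> W k (w k)) ->
       \sum_(k <- s) w k = 0 -> forall k, k \in s -> w k = 0.

End Operators.

Section Cuntz.
Context {K : realType} {H : hilbertSpace K} {d : nat}.
Variable S : 'I_d -> H -> H.
Implicit Types (x u : H -> H).

Definition cuntz_family : Prop :=
  [/\ forall i, bounded_op (S i),
      forall i j, adj (S i) \o S j = (if i == j then idfun else 0) &
      \sum_(i < d) (S i \o adj (S i)) = idfun].

Definition word (mu : seq 'I_d) : H -> H :=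
  foldr (fun i x => S i \o x) idfun mu.

Definition cuntz_alg : set (H -> H) := cstar_generated (range S).

Definition Fn (n : nat) : set (H -> H) :=
  [set x | exists c : n.-tuple 'I_d -> n.-tuple 'I_d -> K[i],
     x = \sum_mu \sum_nu c mu nu *: (word mu \o adj (word nu))].

Definition Falg : set (H -> H) := norm_closure (\bigcup_n Fn n).

Definition vnM : set (H -> H) := commutant (commutant cuntz_alg).

Definition vnN : set (H -> H) := commutant (commutant Falg).

Definition phi x : H -> H := \sum_(i < d) (S i \o x \o adj (S i)).

(* _nR = phi^(n-1)(R) ... phi(R) R *)
Fixpoint lprod (r : H -> H) (n : nat) : H -> H :=
  if n is m.+1 then iter m phi r \o lprod r m else idfun.

(* The isomorphism M_d (x) M_d -> F_d^2 sending the matrix unit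
   e_(i,k) (x) e_(j,l) to S_i S_j (S_k S_l)^*. *)
Definition embed2 (R : 'M[K[i]]_(d * d)) : H -> H :=
  \sum_(p : 'I_d * 'I_d) \sum_(q : 'I_d * 'I_d)
    R (mxtens_index p) (mxtens_index q) *:
      ((S p.1 \o S p.2) \o adj (S q.1 \o S q.2)).

Definition normalized_trace (tau : (H -> H) -> K[i]) : Prop :=
  [/\ forall (a : K[i]) x y, Falg x -> Falg y ->
        tau (a *: x + y) = a * tau x + tau y,
      forall x, Falg x -> 0 <= tau (adj x \o x),
      tau idfun = 1 &
      forall x y, Falg x -> Falg y -> tau (x \o y) = tau (y \o x)].

(* f is the extension to M of the endomorphism lambda_u of O_d; Om is the
   vector implementing omega. *)
Definition lambda_extension (Om : H) u (f : (H -> H) -> (H -> H)) : Prop :=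
  [/\ star_endomorphism vnM f,
      forall i, f (S i) = u \o S i,
      normal_map vnM f,
      forall x, vnM x -> hdot Om (f x Om) = hdot Om (x Om) &
      forall x, vnN x -> vnN (f x)].

Definition cis (t : K) : K[i] := cos t +i* sin t.

Definition cintegral (a b : K) (f : K -> K[i]) : K[i] :=
  (\int[lebesgue_measure]_(t in `[a, b]) complex.Re (f t)) +i*
  (\int[lebesgue_measure]_(t in `[a, b]) complex.Im (f t)).

Variable lam : (H -> H) -> (H -> H) -> (H -> H).

Definition gauge (t : K) : (H -> H) -> (H -> H) :=
  lam (cis t *: (idfun : H -> H)).

(* The operator-valued integral (2 pi)^-1 int_0^(2 pi) gauge_t(x) dt,
   determined by its matrix coefficients. *)
Definition E0 x : H -> H := xget (0 : H -> H)
  [set y | bounded_op y /\ forall xi eta : H,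
     hdot xi (y eta) = ((2 * pi)^-1)%:C *
       cintegral 0 (2 * pi) (fun t => hdot xi (gauge t x eta))].

Definition spectral (k : int) : set (H -> H) :=
  [set x | vnM x /\ forall t : K, gauge t x = cis (t * k%:~R) *: x].

(* H carries the GNS representation of omega = tau o E0 with cyclic vector Om;
   O_d is identified with its image. *)
Definition gns_vector (tau : (H -> H) -> K[i]) (Om : H) : Prop :=
  closure [set x Om | x in cuntz_alg] = setT /\
  forall x, cuntz_alg x -> hdot Om (x Om) = tau (E0 x).

Definition relcomm (r : H -> H) (n : nat) : set (H -> H) :=
  commutant (iter n (lam r) @` vnM) `&` vnM.

Definition relcomm0 (r : H -> H) (n : nat) : set (H -> H) :=
  relcomm r n `&` spectral 0.

End Cuntz.

Definition R_matrix {K : realType} {d : nat} (R : 'M[K[i]]_(d * d)) : Prop :=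
  R \is unitarymx /\
  let R1 : 'M[K[i]]_(d * d * d) := tensmx R (1%:M : 'M[K[i]]_d) in
  let R2 : 'M[K[i]]_(d * d * d) :=
    castmx (mulnA d d d, mulnA d d d) (tensmx (1%:M : 'M[K[i]]_d) R) in
  R1 *m R2 *m R1 = R2 *m R1 *m R2.

(* Main.v *)
From HB Require Import structures.
Require Import Defs.
From mathcomp Require Import all_boot all_order all_algebra.
From mathcomp Require Import all_classical all_reals all_analysis.
From mathcomp Require Import complex mxtens ring lra zify.
Import Order.TTheory GRing.Theory Num.Theory.
Import numFieldNormedType.Exports.
Set Implicit Arguments.
Unset Strict Implicit.
Unset Printing Implicit Defensive.
Local Open Scope classical_set_scope.
Local Open Scope complex_scope.
Local Open Scope ring_scope.

(** Write [W l m] for the span of the [S_mu S_nu^*] with [|mu| = l] and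
    [|nu| = m] (so [W n n] is [F_d^n]), [u] for the unitary [_nR], which lies in
    [W (n + 1) (n + 1)], and [theta = Ad u o phi].

    The braid relation makes [lambda_R] act on [R] and its shifts as [phi]
    ([lam_iter_phi]), so [lambda_R^n] maps [S_i] to [u S_i].  The main part of
    the proof concerns any unitary [u] of [W (n + 1) (n + 1)] together with an
    endomorphism [g] of [M] that preserves [omega] and maps [S_i] to [u S_i].
    An [x] in [M] that commutes with every [u S_i] satisfies
    [x = sum_i x u S_i S_i^* u^* = theta x].  Conversely one must see that a
    fixed point of [theta] in [M] commutes with [g y] for all [y] in [M].

    Everything rests on the KMS condition [omega (x S_i) = d omega (S_i x)]
    ([kms_S]).  It makes right multiplication by [S_i] and by [S_i^*] bounded
    for the norm of [x Om], so that it extends to an operator of the commutant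
    ([right_mult]).  The commutant therefore moves [Om] to a dense set of
    vectors, so [Om] is separating for [M] ([separating]), and the KMS condition
    extends from words to [M] ([kms_extend]).

    Fixed points of [theta] are finite sums of words, for the following reason.
    For [l, m >= n] the map [theta] sends [W l m] to [W (l + 1) (m + 1)]; by
    KMS it preserves [omega], and on vectors [x Om] it maps the orthogonal of
    [W l m] into that of [W (l + 1) (m + 1)] ([theta_orth]).  So if [e] is the
    compression of a fixed point to [W l m], then [theta e] is its compression
    to the larger space [W (l + 1) (m + 1)] and has the same norm: the two
    coincide, and all further compressions agree with [e]
    ([fixed_truncation]).  For each degree [k = l - m] this leaves one fixed
    component [e_k], whose shorter index has length [n].

    The degrees [|k| >= n] are excluded by counting dimensions.  If [e] is a
    nonzero fixed point in [W (n + k) n], then [e e^*] is a fixed point of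
    degree zero, hence already lies in [W n n].  Its range on words of length
    [n + k] then contains as many independent vectors as there are words of
    length [k], although it is contained in the image under [e] of the
    [d ^ n]-dimensional space of words of length [n].  So [d ^ k <= d ^ n], and
    [e] is injective if [k = n] ([fixed_rank]).  In that case [e \o e] is a nonzero fixed point of degree
    [2 n], which the same inequality forbids ([fixed_high_degree]).  Since [Om]
    is separating, a fixed point is the sum of its components [e_k] with
    [|k| < n] ([fixed_decomposition]); its component of degree zero lies in
    [F_d^n].

    A fixed point [x] commutes with [g a] for all words [a].  As [x] is a sum of
    words, right multiplication by [x] is an operator [T] of the commutant, so
    that [x (g a) Om = (g a) x Om = T (g a) Om].  Both sides are continuous in
    [a Om], because [a Om |-> (g a) Om] is isometric, so the identity holds for
    all of [M] ([commutant_fixed]).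

    Finally, by [adj_lprod] and [lam_wspan], the endomorphism [lam (adj r)] acts
    on [F_d^n] as conjugation by [adj u], which turns [theta x = x] into
    [phi S x = lam (adj r) x]. *)

(** * Hilbert spaces *)

Section Subspaces.
Context {K : realType} {V : lmodType K[i]}.
Implicit Types (L : set V) (v w : V).

Definition subspace L :=
  L 0 /\ forall (a : K[i]) v w, L v -> L w -> L (a *: v + w).

Lemma subspaceZ L a v : subspace L -> L v -> L (a *: v).
Proof. by move=> [L0 h] Lv; rewrite -[a *: v]addr0; exact: h. Qed.

Lemma subspaceD L v w : subspace L -> L v -> L w -> L (v + w).
Proof. by move=> [L0 h] Lv Lw; rewrite -[v]scale1r; exact: h. Qed.

Lemma subspaceB L v w : subspace L -> L v -> L w -> L (v - w).
Proof. by move=> [L0 h] Lv Lw; rewrite addrC -scaleN1r; exact: h. Qed.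

Lemma subspace_sum L (I : Type) (s : seq I) (P : pred I) (F : I -> V) :
  subspace L -> (forall i, P i -> L (F i)) -> L (\sum_(i <- s | P i) F i).
Proof. by move=> sL h; apply: big_ind => // [|v w]; [case: sL|exact: subspaceD]. Qed.

End Subspaces.

Section HilbertGeometry.
Context {K : realType} {H : hilbertSpace K}.
Implicit Types (xi eta zeta : H) (a : K[i]) (L D : set H).

Lemma hdotDr xi eta zeta : hdot xi (eta + zeta) = hdot xi eta + hdot xi zeta.
Proof. by rewrite -[eta]scale1r hdot_linear mul1r scale1r. Qed.

Lemma hdot0r xi : hdot xi 0 = 0.
Proof. by apply: (addrI (hdot xi 0)); rewrite -hdotDr !addr0. Qed.

Lemma hdotZr xi a eta : hdot xi (a *: eta) = a * hdot xi eta.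
Proof. by rewrite -[a *: eta]addr0 hdot_linear hdot0r addr0. Qed.

Lemma hdotNr xi eta : hdot xi (- eta) = - hdot xi eta.
Proof. by rewrite -scaleN1r hdotZr mulN1r. Qed.

Lemma hdotBr xi eta zeta : hdot xi (eta - zeta) = hdot xi eta - hdot xi zeta.
Proof. by rewrite hdotDr hdotNr. Qed.

Lemma hdot_sumr (I : Type) (s : seq I) (P : pred I) (F : I -> H) xi :
  hdot xi (\sum_(i <- s | P i) F i) = \sum_(i <- s | P i) hdot xi (F i).
Proof. exact: (big_morph _ (hdotDr xi) (hdot0r xi)). Qed.

Lemma hdotDl xi eta zeta : hdot (xi + eta) zeta = hdot xi zeta + hdot eta zeta.
Proof. by rewrite hdot_conj hdotDr rmorphD /= -!hdot_conj. Qed.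

Lemma hdotZl a xi eta : hdot (a *: xi) eta = a^* * hdot xi eta.
Proof. by rewrite hdot_conj hdotZr rmorphM /= -hdot_conj. Qed.

Lemma hdot0l xi : hdot 0 xi = 0.
Proof. by rewrite hdot_conj hdot0r rmorph0. Qed.

Lemma hdotBl xi eta zeta : hdot (xi - eta) zeta = hdot xi zeta - hdot eta zeta.
Proof. by rewrite hdot_conj hdotBr rmorphB /= -!hdot_conj. Qed.

Lemma hdot_sym0 xi eta : hdot xi eta = 0 -> hdot eta xi = 0.
Proof. by move=> h; rewrite hdot_conj h rmorph0. Qed.

Lemma hdot_eq0 xi : hdot xi xi = 0 -> xi = 0.
Proof. by move=> /eqP; rewrite hdot_norm expf_eq0 normr_eq0 => /eqP. Qed.

Lemma hdot_ext xi eta : (forall zeta, hdot zeta xi = hdot zeta eta) -> xi = eta.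
Proof.
by move=> h; apply/eqP; rewrite -subr_eq0; apply/eqP/hdot_eq0; rewrite hdotBr h subrr.
Qed.

Lemma ge0_real a : 0 <= a -> a = (complex.Re a)%:C.
Proof. by case: a => x y; rewrite lecE /= => /andP[/eqP -> _]. Qed.

(** The norm as a real number: the norm of a complex normed space takes its
    values in [K[i]], where the order is only partial. *)
Definition hn xi : K := complex.Re `|xi|.

Definition cn a : K := complex.Re `|a|.

Lemma cnE a : `|a| = (cn a)%:C.
Proof. exact/ge0_real/normr_ge0. Qed.

Lemma hnE xi : `|xi| = (hn xi)%:C.
Proof. exact/ge0_real/normr_ge0. Qed.

Lemma hn_ge0 xi : 0 <= hn xi.
Proof. by have := normr_ge0 xi; rewrite hnE ler0c. Qed.

Lemma hn0 : hn 0 = 0.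
Proof. by rewrite /hn normr0. Qed.

Lemma hn_eq0 xi : hn xi = 0 -> xi = 0.
Proof. by move=> h; apply/eqP; rewrite -normr_eq0 hnE h. Qed.

Lemma hnD xi eta : hn (xi + eta) <= hn xi + hn eta.
Proof. by have := ler_normD xi eta; rewrite !hnE -rmorphD /= lecR. Qed.

Lemma hnN xi : hn (- xi) = hn xi.
Proof. by rewrite /hn normrN. Qed.

Lemma hnC xi eta : hn (xi - eta) = hn (eta - xi).
Proof. by rewrite -hnN opprB. Qed.

Lemma hnB xi eta zeta : hn (xi - zeta) <= hn (xi - eta) + hn (eta - zeta).
Proof. by have := hnD (xi - eta) (eta - zeta); rewrite addrA subrK. Qed.

Lemma hnZ a xi : hn (a *: xi) = cn a * hn xi.
Proof. by apply: (@complexI K); rewrite rmorphM /= -hnE normrZ cnE hnE. Qed.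

Lemma hn_sqr xi : hdot xi xi = (hn xi ^+ 2)%:C.
Proof. by rewrite hdot_norm hnE rmorphXn. Qed.

Lemma pythagoras xi eta : hdot xi eta = 0 ->
  hn (xi + eta) ^+ 2 = hn xi ^+ 2 + hn eta ^+ 2.
Proof.
move=> h; apply: (@complexI K); rewrite rmorphD /= -!hn_sqr.
by rewrite hdotDl !hdotDr h (hdot_sym0 h) addr0 add0r.
Qed.

Lemma parallelogram xi eta :
  hn (xi + eta) ^+ 2 + hn (xi - eta) ^+ 2 = 2 * (hn xi ^+ 2 + hn eta ^+ 2).
Proof.
rewrite [2]mulr2n mulrDl !mul1r; apply: (@complexI K).
rewrite !rmorphD /= -!hn_sqr !hdotDl !hdotDr -scaleN1r !hdotZl !hdotZr rmorphN1.
by ring.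
Qed.

Lemma cn_ge0 a : 0 <= cn a.
Proof. by have := normr_ge0 a; rewrite cnE ler0c. Qed.

Lemma cauchy_schwarz xi eta : cn (hdot xi eta) <= hn xi * hn eta.
Proof.
have [->|nz] := eqVneq xi 0; first by rewrite hdot0l /cn normr0 hn0 mul0r.
set s := hn xi.
have sgt0 : 0 < s.
  rewrite lt_neqAle hn_ge0 andbT eq_sym; apply: contra_neq nz; exact: hn_eq0.
pose t := hdot xi eta / (s ^+ 2)%:C.
have s2n0 : (s ^+ 2)%:C != 0 :> K[i].
  by rewrite fmorph_eq0 expf_eq0 /= gt_eqF.
have orth : hdot (t *: xi) (eta - t *: xi) = 0.
  by rewrite hdotZl hdotBr hdotZr hn_sqr /t divfK // subrr mulr0.
have := pythagoras orth; rewrite addrC subrK hnZ -/s => pyth.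
have le1 : cn t * s <= hn eta.
  rewrite -ler_sqr ?nnegrE ?hn_ge0 ?mulr_ge0 ?cn_ge0 ?hn_ge0 //.
  by rewrite pyth lerDl sqr_ge0.
have tE : cn t * s ^+ 2 = cn (hdot xi eta).
  apply: (@complexI K); rewrite rmorphM /= -!cnE /t normrM normfV.
  have -> : `|(s ^+ 2)%:C| = (s ^+ 2)%:C :> K[i].
    by rewrite ger0_norm // ler0c sqr_ge0.
  by rewrite divfK.
by rewrite -tE expr2 mulrA [s * _]mulrC ler_wpM2r // ltW.
Qed.

Definition dense_set D := forall xi (e : K), 0 < e -> exists2 y, D y & hn (xi - y) < e.

Lemma closure_dense D : closure D = setT -> dense_set D.
Proof.
move=> cl xi e e0; have : closure D xi by rewrite cl.
move=> /(_ (ball xi e%:C)) []; first by apply: nbhsx_ballx; rewrite ltcR.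
by move=> y [Dy]; rewrite -ball_normE /= hnE ltcR; exists y.
Qed.

(** The sets [P e] generate a Cauchy filter.  Its limit is approached by every
    choice of points in them, so no sequence has to be selected. *)
Lemma complete_family (P : K -> set H) :
  (forall e, 0 < e -> P e !=set0) ->
  (forall e e', e <= e' -> P e `<=` P e') ->
  (forall h, 0 < h -> exists2 e, 0 < e & forall y z, P e y -> P e z -> hn (y - z) < h) ->
  exists p, forall h, 0 < h -> exists2 e, 0 < e & forall y, P e y -> hn (p - y) < h.
Proof.
move=> Pn0 Pmono Psmall.
pose F := filter_from [set e : K | 0 < e] P.
have FF : Filter F.
  apply: filter_from_filter; first by exists 1; exact: ltr01.
  move=> i j /= i0 j0; exists (Num.min i j); first by rewrite /= lt_min i0.
  by move=> y Py; split; apply: Pmono Py; rewrite ge_min lexx ?orbT.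
have PF : ProperFilter F by apply: filter_from_proper.
have : cvg F.
  apply: cauchy_cvg; apply: cauchy_exP => h h0.
  have hE := ge0_real (ltW h0).
  move: h0; rewrite hE -[0]/(0%:C) ltcR => h0.
  have [e e0 small] := Psmall _ h0; have [y Py] := Pn0 _ e0.
  exists y; exists e => // z Pz.
  by rewrite -ball_normE /= hnE ltcR small.
move=> cvF; exists (lim F) => h h0.
have [|e e0 sub] := cvF (ball (lim F) h%:C).
  by apply: nbhsx_ballx; rewrite ltcR.
by exists e => // y /sub; rewrite -ball_normE /= hnE ltcR.
Qed.

End HilbertGeometry.

Section Orthogonal.
Context {K : realType} {H : hilbertSpace K}.
Implicit Types (xi eta zeta : H) (a : K[i]) (L D : set H).

Lemma le_eps (x y : K) : (forall h, 0 < h -> x <= y + h) -> x <= y.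
Proof. by move=> h; apply/ler_addgt0Pr. Qed.

(** By the parallelogram law the almost nearest points of [L] are close to each
    other, so they have a limit [p], possibly outside of [L].  The inequality
    for the translates [p + w] is what remains of minimality. *)
Lemma nearest_point L xi : subspace L -> exists p, exists2 delta,
  forall w, L w -> delta <= hn (xi - p - w) & hn (xi - p) = delta /\
  (forall e, (forall y, L y -> e <= hn (xi - y)) -> e <= delta).
Proof.
move=> [L0 Llin].
pose E := [set hn (xi - y) | y in L].
have infE : has_inf E.
  split; first by exists (hn (xi - 0)), 0.
  by exists 0 => _ [y _ <-]; exact: hn_ge0.
pose delta := inf E; have dle y : L y -> delta <= hn (xi - y).
  by move=> Ly; apply: ge_inf; [case: infE|exists y].
have dge e : (forall y, L y -> e <= hn (xi - y)) -> e <= delta.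
  by move=> h; apply: lb_le_inf; [case: infE|move=> _ [y Ly <-]; exact: h].
have d0 : 0 <= delta by apply: dge => y _; exact: hn_ge0.
pose P e := [set y | L y /\ hn (xi - y) < delta + e].
have Pn0 e : 0 < e -> P e !=set0.
  by move=> e0; have [_ [y Ly <-] ?] := inf_adherent e0 infE; exists y.
have Pmono e e' : e <= e' -> P e `<=` P e'.
  by move=> le y [Ly ly]; split=> //; apply: lt_le_trans ly _; rewrite lerD2l.
have LD y z : L y -> L z -> L (y + z).
  by move=> Ly Lz; rewrite -[y]scale1r; exact: Llin.
have [|p pP] := complete_family Pn0 Pmono.
  (* The parallelogram law gives [hn (y - z) ^+ 2 <= 8 * delta * e + 4 * e ^+ 2]. *)
  move=> h h0; pose e := Num.min 1 (h ^+ 2 / (8 * delta + 5)).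
  have c0 : 0 < 8 * delta + 5 by lra.
  have q0 : 0 < h ^+ 2 / (8 * delta + 5) by rewrite divr_gt0 // exprn_gt0.
  have e0 : 0 < e by rewrite lt_min ltr01.
  exists e => // y z [Ly ly] [Lz lz].
  have mid : 2 * delta <= hn ((xi - y) + (xi - z)).
    have -> : (xi - y) + (xi - z) = 2 *: (xi - 2^-1 *: (y + z)).
      rewrite scalerBr scalerA divff ?pnatr_eq0 // scale1r scaler_nat mulr2n.
      by rewrite opprD addrACA.
    rewrite hnZ.
    have -> : cn (2 : K[i]) = 2.
      by apply: (@complexI K); rewrite -cnE normr_nat rmorph_nat.
    rewrite ler_wpM2l // dle //.
    by rewrite -[_ *: _]addr0; apply: Llin => //; exact: LD.
  have := parallelogram (xi - y) (xi - z).
  have -> : (xi - y) - (xi - z) = z - y by rewrite opprB addrC addrA subrK.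
  rewrite hnC => par.
  have ele : e <= h ^+ 2 / (8 * delta + 5) by rewrite ge_min lexx orbT.
  have e1 : e <= 1 by rewrite ge_min lexx.
  have {}ele : e * (8 * delta + 5) <= h ^+ 2 by rewrite -ler_pdivlMr.
  rewrite -ltr_sqr ?nnegrE ?hn_ge0 ?(ltW h0) //.
  have := hn_ge0 (xi - y); have := hn_ge0 (xi - z).
  move: (hn _) (hn (xi - z)) (hn (xi - y)) (hn (y - z)) ly lz mid par => u v w t.
  move=> ly lz mid par v0 w0.
  have b1 : v ^+ 2 <= (delta + e) ^+ 2 by rewrite ler_sqr ?nnegrE ?addr_ge0 // ltW.
  have b2 : w ^+ 2 <= (delta + e) ^+ 2 by rewrite ler_sqr ?nnegrE ?addr_ge0 // ltW.
  have b3 : (2 * delta) ^+ 2 <= u ^+ 2.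
    by rewrite ler_sqr ?nnegrE ?mulr_ge0 // (le_trans _ mid) ?mulr_ge0.
  by nra.
exists p, delta.
  move=> w Lw; apply: le_eps => h h0.
  have [e e0 cl] := pP _ h0; have [y [Ly ly]] := Pn0 _ e0.
  have := hnD (xi - p - w) (p - y); have := cl _ (conj Ly ly).
  have := dle _ (LD _ _ Ly Lw).
  have -> : xi - p - w + (p - y) = xi - (y + w).
    by rewrite addrACA subrK opprD [- y - w]addrC.
  by lra.
split=> //; apply/eqP; rewrite eq_le; apply/andP; split.
  apply: le_eps => h h0; have [e e0 cl] := pP (h / 2) (divr_gt0 h0 (ltr0Sn _ 1)).
  have m0 : 0 < Num.min e (h / 2) by rewrite lt_min e0 divr_gt0.
  have [y [Ly ly]] := Pn0 _ m0.
  have lm : Num.min e (h / 2) <= h / 2 by rewrite ge_min lexx orbT.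
  have := cl _ (Pmono _ _ _ _ (conj Ly ly)); rewrite ge_min lexx => /(_ isT).
  by have := hnB xi y p; rewrite [hn (y - p)]hnC; move: ly lm; lra.
apply: le_eps => h h0; have [e e0 cl] := pP _ h0.
have [y Py] := Pn0 _ e0; have [Ly _] := Py.
by have := cl _ Py; have := hnB xi p y; have := dle _ Ly; lra.
Qed.

(** The difference between a far point and its nearest point is orthogonal to
    [L]: subtracting a nonzero component along [l] would shorten it. *)
Lemma orth_of_not_dense L : subspace L -> ~ dense_set L ->
  exists2 zeta, zeta <> 0 & forall l, L l -> hdot l zeta = 0.
Proof.
move=> Lsub nd.
have [xi [e [e0 far]]] : exists xi e, 0 < e /\ forall y, L y -> e <= hn (xi - y).
  apply: contrapT => no; apply: nd => xi e e0; apply: contrapT => no2; apply: no.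
  exists xi, e; split=> // y Ly; rewrite leNgt; apply/negP => lt; apply: no2.
  by exists y.
have [p [delta dle [dE dge]]] := nearest_point xi Lsub.
have dp : 0 < delta := lt_le_trans e0 (dge _ far).
exists (xi - p); first by move=> z0; move: dE dp; rewrite z0 hn0 => <-; rewrite ltxx.
move=> l Ll; have [->|nz] := eqVneq l 0; first by rewrite hdot0l.
have s0 : 0 < hn l by rewrite lt_neqAle hn_ge0 andbT eq_sym; apply: contra_neq nz => /hn_eq0.
have s2n0 : (hn l ^+ 2)%:C != 0 :> K[i].
  by rewrite fmorph_eq0 expf_eq0 /= gt_eqF.
pose t := hdot l (xi - p) / (hn l ^+ 2)%:C.
have orth : hdot (t *: l) (xi - p - t *: l) = 0.
  by rewrite hdotZl (hdotBr l) hdotZr hn_sqr /t divfK // subrr mulr0.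
have := pythagoras orth; rewrite addrC subrK dE.
have := dle (t *: l); case: Lsub => L0 Llin.
have Ltl : L (t *: l) by rewrite -[_ *: _]addr0; apply: Llin.
move=> /(_ Ltl) dl pyth.
have dl2 : delta ^+ 2 <= hn (xi - p - t *: l) ^+ 2.
  by rewrite ler_sqr ?nnegrE ?hn_ge0 ?(ltW dp).
have tl0 : hn (t *: l) = 0.
  apply/eqP; rewrite -sqrf_eq0; apply/eqP/le_anti; rewrite sqr_ge0 andbT.
  by move: pyth dl2; lra.
have /eqP := hn_eq0 tl0; rewrite scaler_eq0 (negPf nz) orbF mulf_eq0 invr_eq0.
by rewrite (negPf s2n0) orbF => /eqP.
Qed.

Lemma dense_of_orth L : subspace L ->
  (forall zeta, (forall l, L l -> hdot l zeta = 0) -> zeta = 0) -> dense_set L.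
Proof.
move=> Lsub h; apply: contrapT => /(orth_of_not_dense Lsub)[z nz zL].
exact/nz/h.
Qed.

End Orthogonal.

(** * Bounded operators and their adjoints *)

Section BoundedOperators.
Context {K : realType} {H : hilbertSpace K}.
Implicit Types (xi eta zeta : H) (a : K[i]) (L D : set H) (x y z : H -> H).

Lemma lin_opE a x y xi : (a *: x + y) xi = a *: x xi + y xi. Proof. by []. Qed.

Lemma le0_eps (c u : K) : 0 <= c -> (forall h, 0 < h -> u <= c * h) -> u <= 0.
Proof.
move=> c0 le; apply: le_eps => h h0.
have c1 : 0 < c + 1 by lra.
have := le _ (divr_gt0 h0 c1); rewrite mulrA ler_pdivlMr // => le1.
rewrite add0r -(ler_pM2r c1); apply: le_trans le1 _; rewrite mulrC; nra.
Qed.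

Lemma bounded_opP x : bounded_op x <->
  linear x /\ exists2 C : K, 0 <= C & forall xi, hn (x xi) <= C * hn xi.
Proof.
have pack (lx : linear x) : (exists2 C : K, 0 <= C & forall xi, hn (x xi) <= C * hn xi)
    <-> continuous x.
  pose LX := HB.pack_for {linear H -> H} x (GRing.isLinear.Build _ _ _ _ x lx).
  have E := linear_bounded_continuous LX; have P := linear_boundedP LX.
  split=> [[C C0 le]|/E/P].
    apply/E/P; exists C%:C; split; first by apply: ger0_real; rewrite ler0c.
    move=> r rC xi; rewrite /= -/(x xi) !hnE.
    apply: (@le_trans _ _ (C%:C * (hn xi)%:C)); first by rewrite -rmorphM /= lecR le.
    by rewrite ler_wpM2r ?ler0c ?hn_ge0 // ltW.
  case=> M [Mreal big].
  pose C := cn M + 1; have C1 : 0 < C by rewrite ltr_wpDl ?cn_ge0.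
  have MC : M < C%:C.
    rewrite rmorphD /= -cnE; apply: (@le_lt_trans _ _ `|M|); last by rewrite ltrDl ltr01.
    exact: real_ler_norm.
  exists C; first exact: ltW.
  by move=> xi; have := big _ MC xi; rewrite /= !hnE -rmorphM /= lecR.
by split=> [[lx cx]|[lx bx]]; split=> //; apply/pack.
Qed.

Lemma op_lin x a xi eta : bounded_op x -> x (a *: xi + eta) = a *: x xi + x eta.
Proof. by case=> lx _; exact: lx. Qed.

Lemma op0 x : bounded_op x -> x 0 = 0.
Proof.
by move=> bx; have := op_lin (-1) 0 0 bx; rewrite scaler0 add0r scaleN1r addNr.
Qed.

Lemma opD x xi eta : bounded_op x -> x (xi + eta) = x xi + x eta.
Proof. by move=> bx; rewrite -[xi]scale1r op_lin // !scale1r. Qed.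

Lemma opZ x a xi : bounded_op x -> x (a *: xi) = a *: x xi.
Proof. by move=> bx; rewrite -[a *: xi]addr0 op_lin // op0 // addr0. Qed.

Lemma opB x xi eta : bounded_op x -> x (xi - eta) = x xi - x eta.
Proof. by move=> bx; rewrite addrC -scaleN1r op_lin // scaleN1r addrC. Qed.

Lemma op_sum x (I : Type) (s : seq I) (P : pred I) (F : I -> H) : bounded_op x ->
  x (\sum_(i <- s | P i) F i) = \sum_(i <- s | P i) x (F i).
Proof. by move=> bx; apply: big_morph => [? ?|]; [exact: opD|exact: op0]. Qed.

Lemma bounded_id : bounded_op (idfun : H -> H).
Proof. by apply/bounded_opP; split=> //; exists 1 => // xi; rewrite mul1r. Qed.

Lemma bounded_comp x y : bounded_op x -> bounded_op y -> bounded_op (x \o y).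
Proof.
move=> [lx cx] [ly cy]; split; first by move=> a xi eta /=; rewrite ly lx.
by move=> xi; apply: continuous_comp; [exact: cy|exact: cx].
Qed.

Lemma bounded_lin a x y : bounded_op x -> bounded_op y -> bounded_op (a *: x + y).
Proof.
move=> /bounded_opP[lx [C C0 hC]] /bounded_opP[ly [D D0 hD]]; apply/bounded_opP; split.
  move=> b xi eta; rewrite !lin_opE lx ly !scalerDr !scalerA mulrC; exact: addrACA.
exists (cn a * C + D) => [|xi]; first by rewrite addr_ge0 ?mulr_ge0 ?cn_ge0.
rewrite lin_opE; apply: le_trans (hnD _ _) _.
by rewrite hnZ mulrDl lerD // -mulrA ler_wpM2l ?cn_ge0.
Qed.

Lemma bounded0 : bounded_op (0 : H -> H).
Proof.
apply/bounded_opP; split; first by move=> a xi eta; rewrite scaler0 addr0.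
by exists 0 => // xi; rewrite hn0 mul0r.
Qed.

Lemma boundedZ a x : bounded_op x -> bounded_op (a *: x).
Proof. by move=> bx; rewrite -[a *: x]addr0; apply: bounded_lin => //; exact: bounded0. Qed.

Lemma boundedD x y : bounded_op x -> bounded_op y -> bounded_op (x + y).
Proof. by move=> bx bY; rewrite -[x]scale1r; exact: bounded_lin. Qed.

Lemma boundedB x y : bounded_op x -> bounded_op y -> bounded_op (x - y).
Proof. by move=> bx bY; rewrite addrC -scaleN1r; exact: bounded_lin. Qed.

Lemma bounded_sum (I : Type) (s : seq I) (P : pred I) (F : I -> H -> H) :
  (forall i, P i -> bounded_op (F i)) -> bounded_op (\sum_(i <- s | P i) F i).
Proof. by move=> h; apply: big_ind => //; [exact: bounded0|exact: boundedD]. Qed.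

Lemma compZr x a y : bounded_op x -> x \o (a *: y) = a *: (x \o y).
Proof. by move=> bx; apply/funext => xi; exact: (opZ a (y xi) bx). Qed.

Lemma sum_opE (I : Type) (s : seq I) (P : pred I) (F : I -> H -> H) xi :
  (\sum_(i <- s | P i) F i) xi = \sum_(i <- s | P i) F i xi.
Proof. exact: (big_morph (fun f : H -> H => f xi)). Qed.

Lemma comp_sumr x (I : Type) (s : seq I) (P : pred I) (F : I -> H -> H) : bounded_op x ->
  x \o (\sum_(i <- s | P i) F i) = \sum_(i <- s | P i) (x \o F i).
Proof.
by move=> bx; apply/funext => xi; rewrite sum_opE -[LHS]/(x _) sum_opE op_sum.
Qed.

Lemma comp_suml x (I : Type) (s : seq I) (P : pred I) (F : I -> H -> H) :
  (\sum_(i <- s | P i) F i) \o x = \sum_(i <- s | P i) (F i \o x).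
Proof.
by apply/funext => xi; rewrite sum_opE -[LHS]/((\sum_(i <- s | P i) F i) _) sum_opE.
Qed.

Lemma comp0r x : bounded_op x -> x \o (0 : H -> H) = 0.
Proof. by move=> bx; apply/funext => xi /=; exact: op0. Qed.

(** Either the kernel of [g] is dense and [g] vanishes, or a nonzero vector is
    orthogonal to the kernel, and represents [g] up to a scalar. *)
Lemma riesz (g : H -> K[i]) (C : K) :
  (forall a xi eta, g (a *: xi + eta) = a * g xi + g eta) -> 0 <= C ->
  (forall xi, cn (g xi) <= C * hn xi) ->
  exists eta, forall xi, g xi = hdot eta xi.
Proof.
move=> glin C0 gC.
have g0 : g 0 = 0.
  by have := glin (-1) 0 0; rewrite scaler0 add0r mulN1r addNr.
have gB xi eta : g (xi - eta) = g xi - g eta.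
  by rewrite addrC -scaleN1r glin mulN1r addrC.
have gZ a xi : g (a *: xi) = a * g xi by rewrite -[_ *: _]addr0 glin g0 addr0.
pose L := [set xi | g xi = 0].
have Lsub : subspace L.
  by split=> [//|a xi eta /= h1 h2]; rewrite /L /= glin h1 h2 mulr0 addr0.
have [dL|/(orth_of_not_dense Lsub)[z nz zL]] := pselect (dense_set L).
  exists 0 => xi; rewrite hdot0l; apply/eqP; rewrite -normr_eq0 cnE.
  apply/eqP; congr (_%:C); apply/le_anti; rewrite cn_ge0 andbT.
  apply: (le0_eps C0) => h h0; have [y Ly ly] := dL xi h h0.
  have := gC (xi - y); rewrite gB Ly subr0 => le; apply: le_trans le _.
  by rewrite ler_wpM2l // ltW.
have gz : g z != 0 by apply/eqP => gz0; apply/nz/hdot_eq0/zL.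
have zz : hdot z z != 0 by apply/eqP => /hdot_eq0.
exists ((g z / hdot z z)^* *: z) => xi.
have : hdot z (xi - (g xi / g z) *: z) = 0.
  by apply/hdot_sym0/zL; rewrite /L /= gB gZ divfK // subrr.
rewrite hdotBr hdotZr => /eqP; rewrite subr_eq0 => /eqP E.
by rewrite hdotZl conjCK E; field; rewrite zz gz.
Qed.

Lemma adjoint_exists x : bounded_op x -> exists y, bounded_op y /\
  forall xi eta : H, hdot (x xi) eta = hdot xi (y eta).
Proof.
move=> bx; have /bounded_opP[_ [C C0 hC]] := bx.
have bnd eta xi : cn (hdot eta (x xi)) <= hn eta * C * hn xi.
  apply: le_trans (cauchy_schwarz _ _) _; rewrite -mulrA ler_wpM2l ?hn_ge0 //.
have rep eta : exists z : H, forall xi, hdot eta (x xi) = hdot z xi.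
  apply: (@riesz _ (hn eta * C)); rewrite ?mulr_ge0 ?hn_ge0 //.
  by move=> a xi zeta; rewrite op_lin // hdotDr hdotZr.
have [f fE] := choice rep.
have fE' xi eta : hdot (x xi) eta = hdot xi (f eta).
  by rewrite hdot_conj fE -hdot_conj.
exists f; split=> //; apply/bounded_opP; split.
  by move=> a xi eta; apply: hdot_ext => z; rewrite hdotDr hdotZr -!fE' hdotDr hdotZr.
exists C => // eta.
have [->|nz] := eqVneq (hn (f eta)) 0; first by rewrite mulr_ge0 ?hn_ge0.
have p0 : 0 < hn (f eta) by rewrite lt_neqAle eq_sym nz hn_ge0.
rewrite -(ler_pM2r p0) -expr2.
have -> : hn (f eta) ^+ 2 = cn (hdot eta (x (f eta))).
  by apply: (@complexI K); rewrite -cnE fE hn_sqr ger0_norm // ler0c sqr_ge0.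
by rewrite [C * _]mulrC; exact: bnd.
Qed.

(** Adjoints exist, so the choice made in [adj] never returns its default. *)
Lemma adj_spec x : bounded_op x -> bounded_op (adj x) /\
  forall xi eta : H, hdot (x xi) eta = hdot xi (adj x eta).
Proof. by move=> /adjoint_exists h; exact: (xgetPex (0 : H -> H) h). Qed.

Lemma bounded_adj x : bounded_op x -> bounded_op (adj x).
Proof. by case/adj_spec. Qed.

Lemma adjE x xi eta : bounded_op x -> hdot (x xi) eta = hdot xi (adj x eta).
Proof. by case/adj_spec. Qed.

Lemma adjEr x xi eta : bounded_op x -> hdot xi (x eta) = hdot (adj x xi) eta.
Proof. by move=> bx; rewrite hdot_conj adjE // -hdot_conj. Qed.

Lemma adj_uniq x y : bounded_op x ->
  (forall xi eta : H, hdot (x xi) eta = hdot xi (y eta)) -> adj x = y.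
Proof.
by move=> bx h; apply/funext => eta; apply: hdot_ext => z; rewrite -adjE // h.
Qed.

Lemma adjK x : bounded_op x -> adj (adj x) = x.
Proof.
move=> bx; apply: adj_uniq; first exact: bounded_adj.
by move=> xi eta; rewrite -adjEr.
Qed.

Lemma adj_comp x y : bounded_op x -> bounded_op y -> adj (x \o y) = adj y \o adj x.
Proof.
move=> bx bY; apply: adj_uniq; first exact: bounded_comp.
by move=> xi eta /=; rewrite !adjE.
Qed.

Lemma adj_lin a x y : bounded_op x -> bounded_op y ->
  adj (a *: x + y) = a^* *: adj x + adj y.
Proof.
move=> bx bY; apply: adj_uniq; first exact: bounded_lin.
by move=> xi eta; rewrite !lin_opE hdotDl hdotZl !adjE // -hdotZr -hdotDr.
Qed.

Lemma adj_id : adj (idfun : H -> H) = idfun.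
Proof. by apply: adj_uniq => //; exact: bounded_id. Qed.

Lemma adj0 : adj (0 : H -> H) = 0.
Proof.
by apply: adj_uniq; [exact: bounded0|move=> xi eta; rewrite hdot0l hdot0r].
Qed.

Lemma adjZ a x : bounded_op x -> adj (a *: x) = a^* *: adj x.
Proof.
by move=> bx; rewrite -[a *: x]addr0 adj_lin ?adj0 ?addr0 //; exact: bounded0.
Qed.

Lemma adjD x y : bounded_op x -> bounded_op y -> adj (x + y) = adj x + adj y.
Proof. by move=> bx bY; rewrite -[x]scale1r adj_lin // rmorph1 !scale1r. Qed.

Lemma adj_sum (I : Type) (s : seq I) (P : pred I) (F : I -> H -> H) :
  (forall i, P i -> bounded_op (F i)) ->
  adj (\sum_(i <- s | P i) F i) = \sum_(i <- s | P i) adj (F i).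
Proof.
move=> h; elim: s => [|i s IH]; first by rewrite !big_nil adj0.
rewrite !big_cons; case: ifP => // Pi; rewrite adjD ?IH //; first exact: h.
exact: bounded_sum.
Qed.

(** Completeness extends a densely defined bounded operator.  It is given by its
    graph, since the vectors [x Om] to which it is applied do not come with a
    preferred [x]. *)
Lemma extension (G : H -> H -> Prop) (C : K) :
  G 0 0 -> (forall a p q p' q', G p q -> G p' q' -> G (a *: p + p') (a *: q + q')) ->
  0 <= C -> (forall p q, G p q -> hn q <= C * hn p) ->
  dense_set [set p | exists q, G p q] ->
  exists2 T, bounded_op T & forall p q, G p q -> T p = q.
Proof.
move=> G0 Glin C0 GC dG.
have GB p q p' q' : G p q -> G p' q' -> hn (q - q') <= C * hn (p - p').
  move=> g g'; apply: GC; rewrite (addrC p) (addrC q) -(scaleN1r p') -(scaleN1r q'); exact: Glin.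
have near xi : exists t, forall h, 0 < h -> exists2 e, 0 < e &
    forall p q, G p q -> hn (xi - p) < e -> hn (t - q) < h.
  have [|||t tP] := @complete_family _ _ (fun e => [set q | exists2 p, G p q & hn (xi - p) < e]).
  - by move=> e e0; have [p [q g] l] := dG xi e e0; exists q, p.
  - by move=> e e' le q [p g l]; exists p => //; exact: lt_le_trans le.
  - move=> h h0; pose e := h / (2 * C + 1); have c1 : 0 < 2 * C + 1 by lra.
    have e0 : 0 < e by rewrite divr_gt0.
    exists e => // y z [p g l] [p' g' l'].
    apply: le_lt_trans (GB _ _ _ _ g g') _.
    have le2 : hn (p - p') <= 2 * e by have := hnB p xi p'; rewrite (hnC p xi); lra.
    apply: (@le_lt_trans _ _ (C * (2 * e))); first by rewrite ler_wpM2l.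
    have -> : h = e * (2 * C + 1) by rewrite divfK // gt_eqF.
    by nra.
  exists t => h h0; have [e e0 cl] := tP h h0; exists e => // p q g l.
  by apply: cl; exists p.
have [T TP] := choice near.
have TG p q : G p q -> T p = q.
  move=> g; apply/eqP; rewrite -subr_eq0; apply/eqP/hn_eq0/le_anti; rewrite hn_ge0 andbT.
  apply: (@le0_eps 1) => // h h0; have [e e0 cl] := TP p h h0.
  by rewrite mul1r ltW // (cl p) // subrr hn0.
exists T => //; apply/bounded_opP; split.
  move=> a xi eta; apply/eqP; rewrite -subr_eq0; apply/eqP/hn_eq0/le_anti.
  rewrite hn_ge0 andbT.
  apply: (@le0_eps (2 + cn a)) => [|h h0]; first by rewrite addr_ge0 ?cn_ge0.
  have [e e0 cl] := TP (a *: xi + eta) h h0.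
  have [e1 e10 cl1] := TP xi h h0; have [e2 e20 cl2] := TP eta h h0.
  have ca1 : 0 < cn a + 1 by rewrite ltr_wpDl ?cn_ge0.
  pose m := Num.min e1 (e / 2 / (cn a + 1)); pose m2 := Num.min e2 (e / 2).
  have m0 : 0 < m by rewrite lt_min e10 !divr_gt0.
  have m20 : 0 < m2 by rewrite lt_min e20 !divr_gt0.
  have [p [q g] l] := dG xi m m0; have [p2 [q2 g2] l2] := dG eta m2 m20.
  move: l l2; rewrite !lt_min => /andP[l l'] /andP[l2 l2'].
  have {}cl1 := cl1 _ _ g l; have {}cl2 := cl2 _ _ g2 l2.
  have near0 : hn (a *: xi + eta - (a *: p + p2)) < e.
    rewrite opprD addrACA -scalerBr; apply: le_lt_trans (hnD _ _) _; rewrite hnZ.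
    have : cn a * hn (xi - p) <= e / 2.
      have le := ltW l'; rewrite ler_pdivlMr // in le.
      apply: le_trans le; rewrite mulrC ler_wpM2l ?hn_ge0 //; lra.
    by move: l2'; lra.
  have {}cl := cl _ _ (Glin a _ _ _ _ g g2) near0.
  have -> : T (a *: xi + eta) - (a *: T xi + T eta) =
      (T (a *: xi + eta) - (a *: q + q2)) + (a *: (q - T xi) + (q2 - T eta)).
    rewrite scalerBr [a *: q - _ + _]addrACA -opprD addrA; congr (_ + _).
    by rewrite subrK.
  apply: le_trans (hnD _ _) _; apply: le_trans (lerD (lexx _) (hnD _ _)) _.
  rewrite hnZ (hnC q) (hnC q2).
  have : cn a * hn (T xi - q) <= cn a * h by rewrite ler_wpM2l ?cn_ge0 // ltW.
  by move: cl cl2; lra.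
exists C => // xi; apply: le_eps => h h0; have c1 : 0 < C + 1 by lra.
have k0 : 0 < h / 2 / (C + 1) by rewrite !divr_gt0.
have [e e0 cl] := TP xi (h / 2) (divr_gt0 h0 (ltr0Sn _ 1)).
have m0 : 0 < Num.min e (h / 2 / (C + 1)) by rewrite lt_min e0.
have [p [q g]] := dG xi _ m0; rewrite lt_min => /andP[l l'].
have {}cl := cl _ _ g l; have Cq := GC _ _ g.
have h1 := hnD (T xi - q) q; rewrite subrK in h1.
have h2 := hnD (p - xi) xi; rewrite subrK (hnC p) in h2.
have h3 : C * hn p <= C * (hn (xi - p) + hn xi) by rewrite ler_wpM2l.
have h4 : C * hn (xi - p) <= h / 2.
  have le := ltW l'; rewrite ler_pdivlMr // in le.
  by apply: le_trans le; rewrite mulrC ler_wpM2l ?hn_ge0 //; lra.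
by move: h1 h3 h4 cl Cq; rewrite mulrDr; lra.
Qed.

Lemma cn_small (u : K[i]) (C : K) : 0 <= C ->
  (forall e : K, 0 < e -> cn u <= C * e) -> u = 0.
Proof.
move=> C0 h; apply/eqP; rewrite -normr_eq0 cnE; apply/eqP; congr (_%:C).
by apply/le_anti; rewrite cn_ge0 andbT; exact: le0_eps h.
Qed.

Lemma dense_orth D (v : H) : dense_set D -> (forall y : H, D y -> hdot y v = 0) -> v = 0.
Proof.
move=> dD h; apply: hdot_eq0; apply: (cn_small (hn_ge0 v)) => e e0.
have [y Dy ly] := dD v e e0.
rewrite -[hdot _ _]subr0 -(h _ Dy) -hdotBl.
apply: le_trans (cauchy_schwarz _ _) _; rewrite mulrC ler_wpM2l ?hn_ge0 //.
exact: ltW.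
Qed.

Lemma dense_eq D x y : dense_set D -> bounded_op x -> bounded_op y ->
  (forall v, D v -> x v = y v) -> x = y.
Proof.
move=> dD bx bY h; apply/funext => xi; apply/eqP; rewrite -subr_eq0; apply/eqP.
have bxy := boundedB bx bY; rewrite -[x xi - y xi]/((x - y) xi).
apply: hdot_eq0; rewrite adjE //.
rewrite (_ : adj (x - y) _ = 0) ?hdot0r //.
apply: (dense_orth dD) => v Dv; rewrite -adjE //.
by rewrite -[(x - y) v]/(x v - y v) h // subrr hdot0l.
Qed.

End BoundedOperators.

(** * Independent families of vectors *)

Section FiniteFamilies.
(** The matrix with the rows [a x] has full row rank. *)
Lemma independent_family (F : fieldType) (A B : finType) (a : A -> B -> F) :
  (forall v : A -> F, (forall b : B, \sum_x v x * a x b = 0) -> forall x, v x = 0) ->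
  (#|A| <= #|B|)%N /\
  (#|A| = #|B| -> forall z : B -> F, exists v : A -> F, forall b, z b = \sum_x v x * a x b).
Proof.
move=> free; pose Y := \matrix_(i < #|A|, j < #|B|) a (enum_val i) (enum_val j).
have sumE (v : 'rV[F]_#|A|) b :
    \sum_x v 0 (enum_rank x) * a x b = (v *m Y) 0 (enum_rank b).
  rewrite mxE (reindex_onto enum_val enum_rank) => [|x _]; last exact: enum_rankK.
  rewrite (eq_bigl predT) => [|i]; last by rewrite enum_valK eqxx.
  by apply: eq_bigr => i _; rewrite enum_valK mxE enum_rankK.
have rfree : row_free Y.
  apply: inj_row_free => v vY; apply/rowP => i; rewrite mxE.
  rewrite -(enum_valK i); apply: (free (fun x => v 0 (enum_rank x))) => b.
  by rewrite sumE vY mxE.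
have rk : \rank Y = #|A| by exact/eqP.
split=> [|AB z]; first by rewrite -rk rank_leq_col.
have full : row_full Y by rewrite /row_full rk AB.
pose zr : 'rV[F]_#|B| := \row_j z (enum_val j).
exists (fun x => (zr *m pinvmx Y) 0 (enum_rank x)) => b.
by rewrite sumE mulmxKpV ?submx_full // mxE enum_rankK.
Qed.
End FiniteFamilies.

(** * Words in the Cuntz isometries *)

Section CuntzWords.
Context {K : realType} {H : hilbertSpace K} {d : nat} (S : 'I_d -> H -> H).
Hypothesis hS : cuntz_family S.
Implicit Types (x y z : H -> H) (mu nu : seq 'I_d).

Lemma bounded_S i : bounded_op (S i). Proof. by case: hS. Qed.

Lemma bounded_adjS i : bounded_op (adj (S i)).
Proof. exact/bounded_adj/bounded_S. Qed.

Lemma adjS_S i j : adj (S i) \o S j = if i == j then idfun else 0.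
Proof. by case: hS. Qed.

Lemma sum_SadjS : \sum_(i < d) (S i \o adj (S i)) = idfun.
Proof. by case: hS. Qed.

Lemma bounded_word mu : bounded_op (word S mu).
Proof.
by elim: mu => [|i mu IH]; [exact: bounded_id|apply: bounded_comp; [exact: bounded_S|]].
Qed.

Lemma word_cat mu nu : word S (mu ++ nu) = word S mu \o word S nu.
Proof. by elim: mu => //= i mu ->. Qed.

Lemma adj_word_cons i mu : adj (word S (i :: mu)) = adj (word S mu) \o adj (S i).
Proof. by rewrite /= adj_comp //; [exact: bounded_S|exact: bounded_word]. Qed.

Lemma word_rcons mu i : word S (rcons mu i) = word S mu \o S i.
Proof. by rewrite -cats1 word_cat. Qed.

Lemma adj_word_rcons mu i : adj (word S (rcons mu i)) = adj (S i) \o adj (word S mu).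
Proof. by rewrite word_rcons adj_comp //; [exact: bounded_word|exact: bounded_S]. Qed.

Lemma adj_word_word mu nu : size mu = size nu ->
  adj (word S mu) \o word S nu = if mu == nu then idfun else 0.
Proof.
elim: mu nu => [|i mu IH] [|j nu] //= sz; first by rewrite adj_id.
case: sz => sz.
rewrite -[adj _]/(adj (word S (i :: mu))) adj_word_cons.
rewrite -[LHS]/(adj (word S mu) \o (adj (S i) \o S j) \o word S nu) adjS_S eqseq_cons.
case: eqP => _ /=; first exact: IH.
by apply/funext => xi /=; apply: op0; exact/bounded_adj/bounded_word.
Qed.

(** The homogeneous pieces of the algebra of words: [wspan n n] is [F_d^n], and
    [wspan l m] has degree [l - m] for the gauge action. *)
Definition wspan l m : set (H -> H) :=
  [set x | exists c : l.-tuple 'I_d -> m.-tuple 'I_d -> K[i],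
     x = \sum_mu \sum_nu c mu nu *: (word S mu \o adj (word S nu))].

Lemma wspan_subspace l m : subspace (wspan l m).
Proof.
split.
  exists (fun _ _ => 0); rewrite big1 // => mu _; rewrite big1 // => nu _.
  exact: scale0r.
move=> a _ _ [c ->] [e ->].
exists (fun (mu : l.-tuple 'I_d) (nu : m.-tuple 'I_d) => a * c mu nu + e mu nu).
rewrite scaler_sumr -big_split; apply: eq_bigr => mu _.
rewrite scaler_sumr -big_split; apply: eq_bigr => nu _.
by rewrite scalerDl scalerA.
Qed.

Lemma wspan_gen mu nu : wspan (size mu) (size nu) (word S mu \o adj (word S nu)).
Proof.
exists (fun al be => ((al == in_tuple mu) && (be == in_tuple nu))%:R).
rewrite (bigD1 (in_tuple mu)) //= (bigD1 (in_tuple nu)) //= !eqxx scale1r.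
rewrite !big1 ?addr0 // => [al /negPf h|be /negPf h].
  by rewrite big1 // => be _; rewrite h scale0r.
by rewrite h andbF scale0r.
Qed.

Lemma wspan_ind l m (Q : set (H -> H)) : subspace Q ->
  (forall mu nu, size mu = l -> size nu = m -> Q (word S mu \o adj (word S nu))) ->
  wspan l m `<=` Q.
Proof.
move=> sQ h _ [c ->]; apply: subspace_sum => // mu _; apply: subspace_sum => // nu _.
by apply: subspaceZ => //; apply: h; rewrite size_tuple.
Qed.

Lemma bounded_subspace : subspace (@bounded_op K H).
Proof. by split; [exact: bounded0|exact: bounded_lin]. Qed.

Lemma bounded_gen mu nu : bounded_op (word S mu \o adj (word S nu)).
Proof. by apply: bounded_comp; [|apply: bounded_adj]; exact: bounded_word. Qed.

Lemma wspan_bounded l m : wspan l m `<=` bounded_op.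
Proof. by apply: wspan_ind; [exact: bounded_subspace|move=> *; exact: bounded_gen]. Qed.

Lemma subspace_compl x (Q : set (H -> H)) : bounded_op x -> subspace Q ->
  subspace [set y : H -> H | Q (x \o y)].
Proof.
move=> bx [Q0 Q1]; split=> [|a y z Qy Qz]; first by rewrite /= comp0r.
rewrite /= (_ : _ \o _ = a *: (x \o y) + (x \o z)); first exact: Q1.
by apply/funext => xi; exact: op_lin.
Qed.

Lemma subspace_compr x (Q : set (H -> H)) : subspace Q ->
  subspace [set y : H -> H | Q (y \o x)].
Proof. by move=> [Q0 Q1]; split=> // a y z; exact: Q1. Qed.

Lemma wspan_compl x l m (Q : set (H -> H)) : bounded_op x -> subspace Q ->
  (forall mu nu, size mu = l -> size nu = m -> Q (x \o (word S mu \o adj (word S nu)))) ->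
  forall y, wspan l m y -> Q (x \o y).
Proof. by move=> bx sQ h; apply: wspan_ind => //; exact: subspace_compl. Qed.

Lemma wspan_compr x l m (Q : set (H -> H)) : subspace Q ->
  (forall mu nu, size mu = l -> size nu = m -> Q ((word S mu \o adj (word S nu)) \o x)) ->
  forall y, wspan l m y -> Q (y \o x).
Proof. by move=> sQ h; apply: wspan_ind => //; exact: subspace_compr. Qed.

Lemma adj_gen mu nu : adj (word S mu \o adj (word S nu)) = word S nu \o adj (word S mu).
Proof.
rewrite adj_comp ?adjK //; [exact: bounded_word|exact: bounded_word|].
exact/bounded_adj/bounded_word.
Qed.

Lemma wspan_adj l m x : wspan l m x -> wspan m l (adj x).
Proof.
move=> wx; suff [] : [set x : H -> H | bounded_op x /\ wspan m l (adj x)] x by [].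
move: x wx; apply: wspan_ind.
  split; first by split; [exact: bounded0|rewrite adj0; case: (wspan_subspace m l)].
  move=> a y z [bY wy] [bz wz]; split; first exact: bounded_lin.
  by rewrite adj_lin //; case: (wspan_subspace m l) => _; apply.
by move=> mu nu <- <-; split; [exact: bounded_gen|rewrite adj_gen; exact: wspan_gen].
Qed.

(** Insert [sum_i S_i S_i^* = 1] between [S_mu] and [S_nu^*]. *)
Lemma wspan_succ l m : wspan l m `<=` wspan l.+1 m.+1.
Proof.
apply: wspan_ind; first exact: wspan_subspace.
move=> mu nu <- <-.
have -> : word S mu \o adj (word S nu) =
    \sum_(i < d) (word S (rcons mu i) \o adj (word S (rcons nu i))).
  rewrite -[LHS]/(word S mu \o (idfun \o adj (word S nu))) -sum_SadjS comp_suml comp_sumr.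
    by apply: eq_bigr => i _; rewrite adj_word_rcons word_rcons.
  exact: bounded_word.
apply: subspace_sum => [|i _]; first exact: wspan_subspace.
by rewrite -(size_rcons mu i) -(size_rcons nu i); exact: wspan_gen.
Qed.

Lemma sum_word_adj l : \sum_(mu : l.-tuple 'I_d) (word S mu \o adj (word S mu)) = idfun.
Proof.
elim: l => [|l IH].
  rewrite (big_pred1 [tuple]) => [|mu]; first by rewrite /= adj_id.
  by rewrite /= [mu]tuple0; apply/esym/eqP.
pose h (p : 'I_d * l.-tuple 'I_d) := [tuple of p.1 :: p.2].
rewrite (reindex h) /=; last first.
  exists (fun mu : l.+1.-tuple 'I_d => (thead mu, [tuple of behead mu])) => [[i mu] _|mu _].
    by congr pair; apply/val_inj.
  by rewrite /h /= [RHS]tuple_eta.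
rewrite -(pair_bigA _ (fun (i : 'I_d) (mu : l.-tuple 'I_d) =>
  word S (i :: mu) \o adj (word S (i :: mu)))) /= -[RHS]sum_SadjS.
apply: eq_bigr => i _; rewrite -[RHS]/(S i \o idfun \o adj (S i)) -IH.
rewrite comp_sumr; last exact: bounded_S.
rewrite comp_suml; apply: eq_bigr => mu _.
exact: (congr1 (fun x => word S (i :: mu) \o x) (adj_word_cons i mu)).
Qed.

Lemma wspan_up k l m : wspan l m `<=` wspan (l + k) (m + k).
Proof.
by elim: k => [|k IH] x wx; rewrite ?addn0 // !addnS; apply/wspan_succ/IH.
Qed.

Lemma wspan_mul l m p x y : wspan l m x -> wspan m p y -> wspan l p (x \o y).
Proof.
move=> wx wy; move: x wx; apply: wspan_compr => [|mu nu smu snu]; first exact: wspan_subspace.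
move: y wy; apply: wspan_compl => [||al be sal sbe]; [exact: bounded_gen|exact: wspan_subspace|].
rewrite -[X in wspan _ _ X]/(word S mu \o (adj (word S nu) \o word S al) \o adj (word S be)).
rewrite adj_word_word ?snu //; case: eqP => _; first by rewrite -smu -sbe; exact: wspan_gen.
rewrite comp0r; last exact: bounded_word.
by case: (wspan_subspace l p).
Qed.

Lemma wspan_Sl i l m x : wspan l m x -> wspan l.+1 m (S i \o x).
Proof.
move: x; apply: wspan_compl => [||mu nu <- <-]; [exact: bounded_S|exact: wspan_subspace|].
exact: (wspan_gen (i :: mu)).
Qed.

Lemma wspan_adjSl i l m x : wspan l.+1 m x -> wspan l m (adj (S i) \o x).
Proof.
move: x; apply: wspan_compl => [||[|j mu] nu // [<-] <-].
- exact: bounded_adjS.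
- exact: wspan_subspace.
rewrite -[X in wspan _ _ X]/((adj (S i) \o S j) \o (word S mu \o adj (word S nu))) adjS_S.
by case: eqP => _; [exact: wspan_gen|case: (wspan_subspace (size mu) (size nu))].
Qed.

Lemma wspan_Sr i l m x : wspan l m.+1 x -> wspan l m (x \o S i).
Proof.
move=> wx; rewrite -[_ \o _]adjK.
  rewrite adj_comp; [|exact: wspan_bounded wx|exact: bounded_S].
  exact/wspan_adj/wspan_adjSl/wspan_adj.
by apply: bounded_comp; [exact: wspan_bounded wx|exact: bounded_S].
Qed.

Lemma wspan_adjSr i l m x : wspan l m x -> wspan l m.+1 (x \o adj (S i)).
Proof.
move=> wx; rewrite -[_ \o _]adjK.
  rewrite adj_comp; [|exact: wspan_bounded wx|exact: bounded_adjS].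
  by rewrite adjK; [exact/wspan_adj/wspan_Sl/wspan_adj|exact: bounded_S].
by apply: bounded_comp; [exact: wspan_bounded wx|exact: bounded_adjS].
Qed.

Lemma wspan_word mu : wspan (size mu) 0 (word S mu).
Proof.
have := wspan_gen mu [::].
by rewrite (_ : _ \o _ = word S mu) // /= adj_id.
Qed.

Lemma wspan_id n : wspan n n idfun.
Proof. exact/(@wspan_up n 0 0)/(@wspan_word [::]). Qed.

(** The unital star-algebra generated by the isometries. *)
Definition alg : set (H -> H) :=
  [set x | exists s : seq (K[i] * seq 'I_d * seq 'I_d),
     x = \sum_(p <- s) p.1.1 *: (word S p.1.2 \o adj (word S p.2))].

Lemma alg_subspace : subspace alg.
Proof.
split; first by exists [::]; rewrite big_nil.
move=> a _ _ [s ->] [t ->].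
exists ([seq (a * p.1.1, p.1.2, p.2) | p <- s] ++ t).
rewrite big_cat big_map scaler_sumr; congr (_ + _).
by apply: eq_bigr => p _; rewrite scalerA.
Qed.

Lemma alg_ind (Q : set (H -> H)) : subspace Q -> (forall l m, wspan l m `<=` Q) ->
  alg `<=` Q.
Proof.
move=> sQ h _ [s ->]; apply: subspace_sum => // p _; apply: subspaceZ => //.
exact: h (wspan_gen _ _).
Qed.

Lemma wspan_alg l m : wspan l m `<=` alg.
Proof.
apply: wspan_ind => [|mu nu _ _]; first exact: alg_subspace.
by exists [:: (1, mu, nu)]; rewrite big_seq1 scale1r.
Qed.

Lemma alg_bounded : alg `<=` bounded_op.
Proof. by apply: alg_ind; [exact: bounded_subspace|exact: wspan_bounded]. Qed.

Lemma alg_mul x y : alg x -> alg y -> alg (x \o y).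
Proof.
move=> ax ay; move: x ax; apply: alg_ind; first exact/subspace_compr/alg_subspace.
move=> l m x wx; move: y ay; apply: alg_ind.
  by apply: subspace_compl; [exact: wspan_bounded wx|exact: alg_subspace].
move=> p q y wy; apply: (@wspan_alg (l + p) (q + m)); apply: wspan_mul (wspan_up p wx) _.
by rewrite addnC; exact: wspan_up.
Qed.

Lemma alg_adj x : alg x -> alg (adj x).
Proof.
move=> wx; suff [] : [set x : H -> H | bounded_op x /\ alg (adj x)] x by [].
move: x wx; apply: alg_ind; last first.
  by move=> l m x wx; split; [exact: wspan_bounded wx|exact: (wspan_alg (wspan_adj wx))].
split; first by split; [exact: bounded0|rewrite adj0; case: alg_subspace].
move=> a y z [bY wy] [bz wz]; split; first exact: bounded_lin.
by rewrite adj_lin //; case: alg_subspace => _ h; exact: h.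
Qed.

Lemma alg_id : alg idfun. Proof. exact: (wspan_alg (wspan_id 0)). Qed.

Lemma alg_word mu : alg (word S mu). Proof. exact: (wspan_alg (wspan_word mu)). Qed.

Lemma alg_S i : alg (S i). Proof. exact: (alg_word [:: i]). Qed.

Lemma bounded_phi x : bounded_op x -> bounded_op (phi S x).
Proof.
move=> bx; apply: bounded_sum => i _; apply: bounded_comp; last exact: bounded_adjS.
by apply: bounded_comp => //; exact: bounded_S.
Qed.

Lemma phi_S x i : bounded_op x -> phi S x \o S i = S i \o x.
Proof.
move=> bx; rewrite comp_suml (bigD1 i) //= big1 => [|j /negPf ji].
  by rewrite addr0 -[LHS]/(S i \o x \o (adj (S i) \o S i)) adjS_S eqxx.
rewrite -[LHS]/(S j \o x \o (adj (S j) \o S i)) adjS_S ji comp0r //.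
by apply: bounded_comp => //; exact: bounded_S.
Qed.

Lemma adjS_phi x i : bounded_op x -> adj (S i) \o phi S x = x \o adj (S i).
Proof.
move=> bx; rewrite comp_sumr; last exact: bounded_adjS.
rewrite (bigD1 i) //= big1 => [|j /negPf ji].
  by rewrite addr0 -[LHS]/((adj (S i) \o S i) \o x \o adj (S i)) adjS_S eqxx.
by rewrite -[LHS]/((adj (S i) \o S j) \o x \o adj (S j)) adjS_S eq_sym ji.
Qed.

Lemma phi_lin a x y : phi S (a *: x + y) = a *: phi S x + phi S y.
Proof.
rewrite /phi scaler_sumr -big_split; apply: eq_bigr => i _.
by apply/funext => xi; apply: op_lin; exact: bounded_S.
Qed.

Lemma phi_comp x y : bounded_op x -> bounded_op y -> phi S (x \o y) = phi S x \o phi S y.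
Proof.
move=> bx bY; rewrite [in RHS]/phi comp_suml; apply: eq_bigr => i _.
by rewrite -[RHS]/(S i \o x \o (adj (S i) \o phi S y)) adjS_phi.
Qed.

Lemma phi_id : phi S idfun = idfun. Proof. exact: sum_SadjS. Qed.

Lemma phi_adj x : bounded_op x -> phi S (adj x) = adj (phi S x).
Proof.
have bS := bounded_S; have bS' := bounded_adjS.
move=> bx; rewrite adj_sum => [|i _]; last by apply: bounded_comp => //; exact: bounded_comp.
apply: eq_bigr => i _; rewrite adj_comp ?adjK //; last exact: bounded_comp.
by rewrite adj_comp.
Qed.

Lemma wspan_phi l m x : wspan l m x -> wspan l.+1 m.+1 (phi S x).
Proof.
move=> wx; apply: subspace_sum => [|i _]; first exact: wspan_subspace.
exact/wspan_adjSr/wspan_Sl.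
Qed.

End CuntzWords.

(** * Operator algebras and commutants *)

Section StarAlgebras.
Context {K : realType} {H : hilbertSpace K}.
Implicit Types (x y z : H -> H) (X A B : set (H -> H)).

Lemma norm_closureS X A : X `<=` A -> norm_closure X `<=` norm_closure A.
Proof.
by move=> XA x [bx h]; split=> // e e0; have [y Xy le] := h e e0; exists y => //; exact: XA.
Qed.

Lemma sub_norm_closure X : X `<=` bounded_op -> X `<=` norm_closure X.
Proof.
move=> bX x Xx; split; first exact: bX.
move=> e e0; exists x => // xi; rewrite subrr normr0 mulr_ge0 ?normr_ge0 //.
by rewrite ler0c ltW.
Qed.

Lemma norm_closure_hn X x (e : K) : norm_closure X x -> 0 < e ->
  exists2 y, X y & forall xi, hn (x xi - y xi) <= e * hn xi.
Proof.
move=> [_ h] e0; have [y Xy le] := h e e0; exists y => // xi.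
by have := le xi; rewrite !hnE -rmorphM /= lecR.
Qed.

Lemma norm_limit_eq x y (c c' : K) : 0 <= c -> 0 <= c' ->
  (forall e xi, 0 < e -> hn (x xi - y xi) <= e * (c * hn xi) + e * (c' * hn xi)) -> x = y.
Proof.
move=> c0 c0' h; apply/funext => xi; apply/eqP; rewrite -subr_eq0; apply/eqP/hn_eq0.
apply/le_anti; rewrite hn_ge0 andbT; apply: (@le0_eps _ ((c + c') * hn xi)).
  by rewrite mulr_ge0 ?hn_ge0 ?addr_ge0.
by move=> e e0; apply: le_trans (h e xi e0) _; lra.
Qed.

Lemma bounded_cstar : cstar_subalgebra (@bounded_op K H).
Proof.
split=> [||||x]; [by split=> // x []|exact: bounded_id|exact: bounded_lin| |exact: bounded_adj].
exact: bounded_comp.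
Qed.

Lemma commutant_closed X : X `<=` bounded_op ->
  norm_closure (commutant X) `<=` commutant X.
Proof.
move=> bX x cx; have [bx _] := cx; split=> // y Xy; have bY := bX _ Xy.
have /bounded_opP[_ [C C0 yC]] := bY.
apply: (@norm_limit_eq _ _ C C) => // e xi e0.
have [z [bz /(_ _ Xy) zy] le] := norm_closure_hn cx e0.
have zyE : z (y xi) = y (z xi) by exact: (congr1 (@^~ xi) zy).
rewrite -[(x \o y) xi - _]/(x (y xi) - y (x xi)).
apply: le_trans (hnB _ (z (y xi)) _) _; apply: lerD.
  by apply: le_trans (le _) _; rewrite ler_wpM2l ?yC ?(ltW e0).
rewrite zyE -opB //; apply: le_trans (yC _) _.
rewrite mulrCA ler_wpM2l //.
by rewrite hnC; exact: le.
Qed.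

Lemma commutant_cstar X : X `<=` bounded_op -> (forall x, X x -> X (adj x)) ->
  cstar_subalgebra (commutant X).
Proof.
move=> bX aX; split.
- by split=> [x []//|]; exact: commutant_closed.
- by split; [exact: bounded_id|].
- move=> a x y [bx xc] [bY yc]; split=> [|z Xz]; first exact: bounded_lin.
  rewrite -[LHS]/(a *: (x \o z) + (y \o z)) xc // yc //.
  by apply/funext => xi; rewrite [RHS](op_lin _ _ _ (bX _ Xz)).
- move=> x y [bx xc] [bY yc]; split=> [|z Xz]; first exact: bounded_comp.
  by rewrite -[LHS]/(x \o (y \o z)) yc // -[LHS]/((x \o z) \o y) xc.
- move=> x [bx xc]; split=> [|z Xz]; first exact: bounded_adj.
  have bz := bX _ Xz; rewrite -[z]adjK // -!adj_comp //; try exact: bounded_adj.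
  by rewrite xc //; exact: aX.
Qed.

Lemma sub_bicommutant X : X `<=` bounded_op -> X `<=` commutant (commutant X).
Proof.
by move=> bX x Xx; split=> [|y [_ yc]]; [exact: bX|rewrite yc].
Qed.

Lemma commutantS X A : X `<=` A -> commutant A `<=` commutant X.
Proof. by move=> XA y [bY yc]; split=> // x /XA; exact: yc. Qed.

Lemma commutant_bounded X : commutant X `<=` bounded_op.
Proof. by move=> x []. Qed.

Lemma bicommutant_cstar A : cstar_subalgebra A ->
  cstar_subalgebra (commutant (commutant A)).
Proof.
move=> [[bA _] _ _ _ aA]; apply: commutant_cstar; first exact: commutant_bounded.
by have [_ _ _ _] := commutant_cstar bA aA.
Qed.

Lemma generated_cstar X : X `<=` bounded_op -> cstar_subalgebra (cstar_generated X).
Proof.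
move=> bX; have sub A : cstar_subalgebra A -> X `<=` A -> cstar_generated X `<=` A.
  by move=> cA XA x; apply.
split.
- split; first by apply: sub => //; exact: bounded_cstar.
  move=> x cx A cA XA; have [[_ clA] _ _ _ _] := cA.
  by apply: clA; move: x cx; apply: norm_closureS; exact: sub.
- by move=> A [].
- move=> a x y cx cy A cA XA; have [_ _ linA _ _] := cA.
  by apply: linA; [exact: cx|exact: cy].
- move=> x y cx cy A cA XA; have [_ _ _ mulA _] := cA.
  by apply: mulA; [exact: cx|exact: cy].
- by move=> x cx A cA XA; have [_ _ _ _ adjA] := cA; apply: adjA; exact: cx.
Qed.

Lemma cstar_subspace A : cstar_subalgebra A -> subspace A.
Proof.
move=> [_ A1 linA _ _]; split=> //.
by rewrite -[0](addNr idfun) -scaleN1r; exact: linA.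
Qed.

End StarAlgebras.

Section CuntzVN.
Context {K : realType} {H : hilbertSpace K} {d : nat} (S : 'I_d -> H -> H).
Hypothesis hS : cuntz_family S.
Implicit Types (x y z : H -> H) (mu nu : seq 'I_d).

Lemma range_S_bounded : range S `<=` bounded_op.
Proof. by move=> ? [i _ <-]; exact: bounded_S. Qed.

Lemma cuntz_cstar : cstar_subalgebra (cuntz_alg S).
Proof. exact/generated_cstar/range_S_bounded. Qed.

Lemma cuntz_S i : cuntz_alg S (S i).
Proof. by move=> A cA; apply; exists i. Qed.

Lemma cstar_wspan A : cstar_subalgebra A -> range S `<=` A -> forall l m, wspan S l m `<=` A.
Proof.
move=> cA SA l m; have [_ A1 _ mulA adjA] := cA.
have Aword mu : A (word S mu).
  by elim: mu => [//|i mu IH]; apply: mulA => //; apply: SA; exists i.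
apply: wspan_ind; first exact: cstar_subspace.
by move=> mu nu _ _; apply: mulA => //; exact: adjA.
Qed.

Lemma cstar_alg A : cstar_subalgebra A -> range S `<=` A -> alg S `<=` A.
Proof.
by move=> cA SA; apply: alg_ind; [exact: cstar_subspace|exact: cstar_wspan].
Qed.

Lemma alg_cuntz : alg S `<=` cuntz_alg S.
Proof. by apply: cstar_alg; [exact: cuntz_cstar|move=> ? [i _ <-]; exact: cuntz_S]. Qed.

Lemma wspan_Falg n : wspan S n n `<=` Falg S.
Proof.
move=> x wx; apply: sub_norm_closure; last by exists n.
by move=> ? [m _]; exact: (wspan_bounded hS (m := m)).
Qed.

Lemma Falg_cuntz : Falg S `<=` cuntz_alg S.
Proof.
have [[_ cl] _ _ _ _] := cuntz_cstar.
move=> x Fx; apply: cl; move: x Fx; apply: norm_closureS => x [m _ wx].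
exact: (alg_cuntz (wspan_alg wx)).
Qed.

Lemma vnM_cstar : cstar_subalgebra (vnM S).
Proof. exact/bicommutant_cstar/cuntz_cstar. Qed.

Lemma cuntz_vnM : cuntz_alg S `<=` vnM S.
Proof. by have [[b _] _ _ _ _] := cuntz_cstar; exact: sub_bicommutant. Qed.

Lemma alg_vnM : alg S `<=` vnM S.
Proof. by move=> x /alg_cuntz; exact: cuntz_vnM. Qed.

Lemma wspan_vnM l m : wspan S l m `<=` vnM S.
Proof. by move=> x wx; exact: (alg_vnM (wspan_alg wx)). Qed.

Lemma vnN_vnM : vnN S `<=` vnM S.
Proof. by apply: commutantS; apply: commutantS; exact: Falg_cuntz. Qed.

Lemma wspan_vnN n : wspan S n n `<=` vnN S.
Proof.
move=> x wx; apply: sub_bicommutant; last exact: wspan_Falg wx.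
by move=> y [].
Qed.

Lemma vnM_bounded : vnM S `<=` bounded_op. Proof. by move=> x []. Qed.

Lemma vnM_mul x y : vnM S x -> vnM S y -> vnM S (x \o y).
Proof. by have [_ _ _ h _] := vnM_cstar; exact: h. Qed.

Lemma vnM_adj x : vnM S x -> vnM S (adj x).
Proof. by have [_ _ _ _ h] := vnM_cstar; exact: h. Qed.

Lemma vnM_subspace : subspace (vnM S).
Proof. exact/cstar_subspace/vnM_cstar. Qed.

Lemma vnM_id : vnM S idfun. Proof. by have [_ h _ _ _] := vnM_cstar. Qed.

Lemma vnM_S i : vnM S (S i). Proof. exact: (cuntz_vnM (cuntz_S _)). Qed.

Lemma vnM_phi x : vnM S x -> vnM S (phi S x).
Proof.
move=> Mx; apply: subspace_sum => [|i _]; first exact: vnM_subspace.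
by apply: vnM_mul; [apply: vnM_mul => //|apply: vnM_adj]; exact: vnM_S.
Qed.

(** The commutant of [T] and [adj T] is a C*-algebra that contains the
    generators. *)
Lemma cuntz_commutant T : bounded_op T -> (forall i, T \o S i = S i \o T) ->
  (forall i, T \o adj (S i) = adj (S i) \o T) -> commutant (cuntz_alg S) T.
Proof.
move=> bT TS TS'; have bT' := bounded_adj bT; split=> // x cx.
pose X := [set y : H -> H | y = T \/ y = adj T].
have cX : cstar_subalgebra (commutant X).
  apply: commutant_cstar => [y [->|->] //|y [->|->]]; first by right.
  by left; rewrite adjK.
have [|_ /(_ T)] := cx _ cX; last by move=> <- //; left.
move=> ? [i _ <-]; have bSi := bounded_S hS i; split=> // y [->|->]; first by rewrite TS.
by rewrite -[S i]adjK // -!adj_comp ?TS' //; exact: bounded_adj.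
Qed.

Lemma vnM_commutant x T : vnM S x -> commutant (cuntz_alg S) T -> x \o T = T \o x.
Proof. by move=> [_ h] /h. Qed.

(** The operators that preserve, together with their adjoints, the orthogonal of
    the vectors [x Om] with [x] in [alg S] form a C*-algebra containing the
    generators.  So a vector of this orthogonal is orthogonal to
    [cuntz_alg S] applied to [Om], which is dense. *)
Lemma alg_dense Om : closure [set x Om | x in cuntz_alg S] = setT ->
  dense_set [set x Om | x in alg S].
Proof.
move=> /closure_dense cyc; apply: dense_of_orth.
  split; first by exists 0 => //; case: (alg_subspace S).
  move=> a _ _ [x ax <-] [y ay <-]; exists (a *: x + y) => //.
  by case: (alg_subspace S) => _; exact.
move=> z zA.
pose P := [set v : H | forall x, alg S x -> hdot (x Om) v = 0].
pose B := [set x : H -> H | bounded_op x /\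
  forall v, P v -> P (x v) /\ P (adj x v)].
have PB (a : K[i]) v w : P v -> P w -> P (a *: v + w).
  by move=> Pv Pw x ax; rewrite hdotDr hdotZr Pv // Pw // mulr0 addr0.
have cB : cstar_subalgebra B.
  split.
  - split=> [x []//|x cx]; have [bx _] := cx; split=> // v Pv; split=> y ay.
      apply: (cn_small (mulr_ge0 (hn_ge0 (y Om)) (hn_ge0 v))) => e e0.
      have [w [bw /(_ _ Pv) [Pw _]] le] := norm_closure_hn cx e0.
      rewrite -[hdot _ _]subr0 -(Pw _ ay) -hdotBr.
      apply: le_trans (cauchy_schwarz _ _) _; rewrite -mulrA ler_wpM2l ?hn_ge0 //.
      by rewrite mulrC; exact: le.
    apply: (cn_small (mulr_ge0 (hn_ge0 (y Om)) (hn_ge0 v))) => e e0.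
    have [w [bw /(_ _ Pv) [_ Pw]] le] := norm_closure_hn cx e0.
    rewrite -adjE // -[hdot _ _]subr0 -(Pw _ ay) -adjE // -hdotBl.
    apply: le_trans (cauchy_schwarz _ _) _; rewrite mulrAC ler_wpM2r ?hn_ge0 //.
    by rewrite mulrC; exact: le.
  - by split=> [|v Pv]; [exact: bounded_id|rewrite adj_id].
  - move=> a x y [bx hx] [bY hy]; split=> [|v Pv]; first exact: bounded_lin.
    have [Px Px'] := hx _ Pv; have [Py Py'] := hy _ Pv; split; first exact: PB.
    by rewrite adj_lin //; exact: PB.
  - move=> x y [bx hx] [bY hy]; split=> [|v Pv]; first exact: bounded_comp.
    rewrite adj_comp //; split; first by have [/hx[]] := hy _ Pv.
    by have [_ /hy[]] := hx _ Pv.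
  - move=> x [bx hx]; split=> [|v Pv]; first exact: bounded_adj.
    by rewrite adjK //; have [] := hx _ Pv.
have SB : range S `<=` B.
  move=> ? [i _ <-]; split=> [|v Pv]; first exact: bounded_S.
  have aS : alg S (S i) by exact: alg_S.
  split=> x ax.
    rewrite adjEr ?Pv //; last exact: bounded_S.
    by apply: (Pv (adj (S i) \o x)); apply: alg_mul => //; exact: alg_adj.
  rewrite -adjE; last exact: bounded_S.
  by apply: (Pv (S i \o x)); exact: alg_mul.
have Pz : P z by move=> x ax; apply: zA; exists x.
have orth x : cuntz_alg S x -> hdot (x Om) z = 0.
  move=> cx; have [bx /(_ _ Pz) [_ Px]] := cx _ cB SB.
  by rewrite adjE //; apply: (Px idfun); exact: alg_id.
by apply: (dense_orth cyc) => _ [x cx <-]; exact: orth.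
Qed.

End CuntzVN.

(** * Matrices acting through Cuntz families *)

Section MatrixUnits.
Context {K : realType} {H : hilbertSpace K}.
Implicit Types (N : nat).

(** The representation of the matrix algebra in which [T a \o adj (T b)] is a
    matrix unit.  The embedding [embed2] is the case of the family [S_i S_j]. *)
Definition mxop N (T : 'I_N -> H -> H) (A : 'M[K[i]]_N) : H -> H :=
  \sum_a \sum_b A a b *: (T a \o adj (T b)).

Section Fixed.
Context (N : nat) (T : 'I_N -> H -> H).
Hypothesis hT : cuntz_family T.

Let bT := bounded_S hT.
Let bT' := bounded_adjS hT.

Lemma bounded_unit a b : bounded_op (T a \o adj (T b)).
Proof. exact: bounded_comp. Qed.

Lemma bounded_mxop A : bounded_op (mxop T A).
Proof.
apply: bounded_sum => a _; apply: bounded_sum => b _.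
by apply: boundedZ; exact: bounded_unit.
Qed.

Lemma adj_mxop c A : adj (T c) \o mxop T A = \sum_b A c b *: adj (T b).
Proof.
rewrite /mxop comp_sumr // (bigD1 c) //= [X in _ + X]big1 => [|a na].
  rewrite addr0 comp_sumr //; apply: eq_bigr => b _.
  by rewrite compZr // -[_ \o _]/((adj (T c) \o T c) \o adj (T b)) adjS_S // eqxx.
rewrite comp_sumr // big1 // => b _.
rewrite compZr // -[_ \o _]/((adj (T c) \o T a) \o adj (T b)) adjS_S // eq_sym (negPf na).
exact: scaler0.
Qed.

(** Comparing rows [adj (T c) \o x] turns identities of double sums into
    identities of single sums. *)
Lemma eq_coef x y : bounded_op x -> bounded_op y ->
  (forall c, adj (T c) \o x = adj (T c) \o y) -> x = y.
Proof.
move=> bx bY h; rewrite -[x]/(idfun \o x) -[y]/(idfun \o y) -(sum_SadjS hT) !comp_suml.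
by apply: eq_bigr => c _; exact: (congr1 (fun f : H -> H => T c \o f) (h c)).
Qed.

Lemma mxop_comp A B : mxop T A \o mxop T B = mxop T (A *m B).
Proof.
apply: eq_coef => [||c]; [by apply: bounded_comp; exact: bounded_mxop|exact: bounded_mxop|].
rewrite -[LHS]/((adj (T c) \o mxop T A) \o mxop T B) !adj_mxop comp_suml.
under eq_bigr => b _.
  rewrite -[(_ *: _) \o _]/(A c b *: (adj (T b) \o mxop T B)) adj_mxop scaler_sumr.
  over.
rewrite exchange_big; apply: eq_bigr => e _; rewrite mxE scaler_suml.
by apply: eq_bigr => b _; rewrite scalerA.
Qed.

Lemma mxop1 : mxop T 1%:M = idfun.
Proof.
rewrite -(sum_SadjS hT); apply: eq_bigr => a _.
rewrite (bigD1 a) //= big1 => [|b nb]; first by rewrite mxE eqxx scale1r addr0.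
by rewrite mxE eq_sym (negPf nb) scale0r.
Qed.

Lemma mxop_adj A : adj (mxop T A) = mxop T (map_mx Num.conj A^T).
Proof.
rewrite /mxop adj_sum => [|a _]; last first.
  by apply: bounded_sum => b _; apply: boundedZ; exact: bounded_unit.
rewrite exchange_big /=; apply: eq_bigr => a _; rewrite adj_sum => [|b _]; last first.
  by apply: boundedZ; exact: bounded_unit.
apply: eq_bigr => b _; rewrite (adjZ _ (bounded_unit a b)) !mxE.
by rewrite (adj_comp (bT a) (bT' b)) (adjK (bT b)).
Qed.

Lemma mxop_unitary A : A \is unitarymx -> unitary_op (mxop T A).
Proof.
move=> uA; have AA' : A *m map_mx Num.conj A^T = 1%:M by apply/unitarymxP.
split; first exact: bounded_mxop.
  by rewrite mxop_adj mxop_comp (mulmx1C AA') mxop1.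
by rewrite mxop_adj mxop_comp AA' mxop1.
Qed.

End Fixed.

Definition prod_family N N' (T : 'I_N -> H -> H) (T' : 'I_N' -> H -> H)
    (c : 'I_(N * N')) : H -> H :=
  T (mxtens_unindex c).1 \o T' (mxtens_unindex c).2.

Lemma sum_mxtens (V : nmodType) N N' (F : 'I_(N * N') -> V) :
  \sum_c F c = \sum_a \sum_b F (mxtens_index (a, b)).
Proof.
rewrite (reindex (@mxtens_index N N')) /=; last first.
  by exists (@mxtens_unindex N N') => c _; rewrite ?mxtens_indexK ?mxtens_unindexK.
by rewrite pair_bigA; apply: eq_bigr => -[a b].
Qed.

Section Product.
Context (N N' : nat) (T : 'I_N -> H -> H) (T' : 'I_N' -> H -> H).
Hypotheses (hT : cuntz_family T) (hT' : cuntz_family T').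

Let bT := bounded_S hT.
Let bT' := bounded_S hT'.

Lemma prod_familyE a b : prod_family T T' (mxtens_index (a, b)) = T a \o T' b.
Proof. by rewrite /prod_family mxtens_indexK. Qed.

Lemma adj_prod_family a b :
  adj (prod_family T T' (mxtens_index (a, b))) = adj (T' b) \o adj (T a).
Proof. by rewrite prod_familyE (adj_comp (bT a) (bT' b)). Qed.

Lemma prod_family_cuntz : cuntz_family (prod_family T T').
Proof.
split=> [c|c c'|]; first exact: bounded_comp.
  case: (mxtens_unindex c) (mxtens_unindexK c) => a b <-.
  case: (mxtens_unindex c') (mxtens_unindexK c') => a' b' <-.
  rewrite adj_prod_family prod_familyE (can_eq (@mxtens_indexK _ _)) xpair_eqE.
  rewrite -[LHS]/(adj (T' b) \o (adj (T a) \o T a') \o T' b') adjS_S //.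
  case: eqP => _ /=; first exact: adjS_S.
  by apply: comp0r; exact: bounded_adjS.
rewrite sum_mxtens -(sum_SadjS hT); apply: eq_bigr => a _.
under eq_bigr => b _ do rewrite adj_prod_family prod_familyE.
rewrite -[RHS]/(T a \o idfun \o adj (T a)) -(sum_SadjS hT') comp_sumr // comp_suml.
exact: eq_bigr.
Qed.

Lemma mxop_tensl A : mxop (prod_family T T') (A *t 1%:M) = mxop T A.
Proof.
have bA := bounded_mxop hT A; have hP := prod_family_cuntz.
apply: (eq_coef hP) => // [|c]; first exact: bounded_mxop.
rewrite (adj_mxop hP); case: (mxtens_unindex c) (mxtens_unindexK c) => a b <-.
rewrite sum_mxtens adj_prod_family.
rewrite -[RHS]/(adj (T' b) \o (adj (T a) \o mxop T A)) (adj_mxop hT).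
have bb := bounded_adjS hT' b; rewrite comp_sumr //.
apply: eq_bigr => e _; rewrite compZr // (bigD1 b) //= big1 => [|f nf].
  by rewrite addr0 tensmxE adj_prod_family mxE eqxx mulr1.
by rewrite tensmxE mxE eq_sym (negPf nf) mulr0 scale0r.
Qed.

Lemma mxop_tensr A : mxop (prod_family T T') (1%:M *t A) = phi T (mxop T' A).
Proof.
have bA := bounded_mxop hT' A; have hP := prod_family_cuntz.
apply: (eq_coef hP) => [||c]; [exact: bounded_mxop|exact: bounded_phi|].
rewrite (adj_mxop hP); case: (mxtens_unindex c) (mxtens_unindexK c) => a b <-.
rewrite sum_mxtens adj_prod_family.
rewrite -[RHS]/(adj (T' b) \o (adj (T a) \o phi T (mxop T' A))) (adjS_phi hT) //.
rewrite -[RHS]/((adj (T' b) \o mxop T' A) \o adj (T a)) (adj_mxop hT') comp_suml.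
rewrite (bigD1 a) //= [X in _ + X]big1 => [|e ne].
  rewrite addr0; apply: eq_bigr => f _.
  by rewrite tensmxE adj_prod_family mxE eqxx mul1r.
by rewrite big1 // => f _; rewrite tensmxE mxE eq_sym (negPf ne) mul0r scale0r.
Qed.

End Product.
Section YangBaxter.
Context (d : nat) (S : 'I_d -> H -> H).
Hypothesis hS : cuntz_family S.

Let S2 := prod_family S S.
Let S3 := prod_family S2 S.
Let hS2 : cuntz_family S2. Proof. exact: prod_family_cuntz. Qed.
Let hS3 : cuntz_family S3. Proof. exact: prod_family_cuntz. Qed.

Lemma embed2E A : embed2 S A = mxop S2 A.
Proof.
rewrite /embed2 /mxop [RHS]sum_mxtens [RHS]pair_bigA; apply: eq_bigr => -[a b] _.
rewrite [RHS]sum_mxtens [RHS]pair_bigA; apply: eq_bigr => -[e f] _.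
by rewrite /S2 !prod_familyE.
Qed.

(** Both sides are [S_i S_j S_k] for the digits [i], [j], [k] of [c] in base
    [d]. *)
Lemma prod_familyA (c : 'I_(d * (d * d))) :
  S3 (cast_ord (mulnA d d d) c) = prod_family S S2 c.
Proof.
rewrite /S3 /S2 /prod_family.
have E1 : (mxtens_unindex (mxtens_unindex (cast_ord (mulnA d d d) c)).1).1 =
    (mxtens_unindex c).1.
  by apply: val_inj; rewrite /= divnMA.
have E2 : (mxtens_unindex (mxtens_unindex (cast_ord (mulnA d d d) c)).1).2 =
    (mxtens_unindex (mxtens_unindex c).2).1.
  by apply: val_inj; rewrite /= modn_divl.
have E3 : (mxtens_unindex (cast_ord (mulnA d d d) c)).2 =
    (mxtens_unindex (mxtens_unindex c).2).2.
  by apply: val_inj; rewrite /= modn_dvdm // dvdn_mull.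
by rewrite E1 E2 E3.
Qed.

Lemma mxop_cast (A : 'M[K[i]]_(d * (d * d))) :
  mxop S3 (castmx (mulnA d d d, mulnA d d d) A) = mxop (prod_family S S2) A.
Proof.
rewrite /mxop (reindex (cast_ord (mulnA d d d))) /=; last first.
  by exists (cast_ord (esym (mulnA d d d))) => c _; rewrite ?cast_ordK ?cast_ordKV.
apply: eq_bigr => a _; rewrite (reindex (cast_ord (mulnA d d d))) /=; last first.
  by exists (cast_ord (esym (mulnA d d d))) => c _; rewrite ?cast_ordK ?cast_ordKV.
by apply: eq_bigr => b _; rewrite castmxE /= !cast_ordK !prod_familyA.
Qed.

Lemma embed2_unitary R : R \is unitarymx -> unitary_op (embed2 S R).
Proof. by rewrite embed2E; exact: mxop_unitary. Qed.

Lemma embed2_braid R : R_matrix R ->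
  embed2 S R \o phi S (embed2 S R) \o embed2 S R =
  phi S (embed2 S R) \o embed2 S R \o phi S (embed2 S R).
Proof.
case=> _ /= /(congr1 (mxop S3)).
by rewrite -!(mxop_comp hS3) mxop_cast !(mxop_tensl hS2 hS) (mxop_tensr hS hS2) -embed2E.
Qed.

Lemma embed2_wspan R : wspan S 2 2 (embed2 S R).
Proof.
apply: subspace_sum => [|p _]; first exact: wspan_subspace.
apply: subspace_sum => [|q _]; first exact: wspan_subspace.
apply: subspaceZ; first exact: wspan_subspace.
exact: (wspan_gen S [:: p.1; p.2] [:: q.1; q.2]).
Qed.

End YangBaxter.
End MatrixUnits.

(** * Endomorphisms and the gauge action *)

Section Cis.
Context {K : realType}.
Implicit Types (s t : K).

Lemma cis0 : cis 0 = 1 :> K[i]. Proof. by rewrite /cis cos0 sin0. Qed.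

Lemma cisD s t : cis (s + t) = cis s * cis t.
Proof. by rewrite /cis cosD sinD; congr (_ +i* _); rewrite addrC [cos s * _]mulrC; ring. Qed.

Lemma cis_conj t : (cis t)^* = cis (- t).
Proof. by rewrite /cis cosN sinN. Qed.

Lemma cis_pi : cis (pi : K) = -1.
Proof. by rewrite /cis cospi sinpi; apply/eqP; rewrite eq_complex /= oppr0 !eqxx. Qed.

Lemma cis_conjK t : (cis t)^* * cis t = 1.
Proof. by rewrite cis_conj -cisD addNr cis0. Qed.

End Cis.

Section StarEndo.
Context {K : realType} {H : hilbertSpace K} (M : set (H -> H)) (f : (H -> H) -> (H -> H)).
Hypotheses (cM : cstar_subalgebra M) (sf : star_endomorphism M f).
Implicit Types (x y : H -> H).

Lemma endo_in x : M x -> M (f x). Proof. by case: sf => h _ _ _ _; exact: h. Qed.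

Lemma endo_id : f idfun = idfun. Proof. by case: sf. Qed.

Lemma endo_lin a x y : M x -> M y -> f (a *: x + y) = a *: f x + f y.
Proof. by case: sf => _ _ h _ _; exact: h. Qed.

Lemma endo_comp x y : M x -> M y -> f (x \o y) = f x \o f y.
Proof. by case: sf => _ _ _ h _; exact: h. Qed.

Lemma endo_adj x : M x -> f (adj x) = adj (f x).
Proof. by case: sf => _ _ _ _ h; exact: h. Qed.

Lemma endo0 : f 0 = 0.
Proof.
have M1 : M idfun by case: cM.
by rewrite -[in LHS](addNr idfun) -scaleN1r endo_lin // scaleN1r addNr.
Qed.

Lemma endoD x y : M x -> M y -> f (x + y) = f x + f y.
Proof. by move=> Mx My; rewrite -[x]scale1r endo_lin // !scale1r. Qed.

Lemma endoB x y : M x -> M y -> f (x - y) = f x - f y.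
Proof. by move=> Mx My; rewrite addrC -scaleN1r endo_lin // scaleN1r addrC. Qed.

Lemma endo_sum (I : Type) (s : seq I) (P : pred I) (F : I -> H -> H) :
  (forall i, P i -> M (F i)) -> f (\sum_(i <- s | P i) F i) = \sum_(i <- s | P i) f (F i).
Proof.
move=> MF; elim: s => [|i s IH]; first by rewrite !big_nil endo0.
rewrite !big_cons; case: ifP => // Pi; rewrite endoD ?IH //; first exact: MF.
by apply: subspace_sum => //; exact: cstar_subspace.
Qed.

Lemma endo_isometry Om x :
  (forall x, M x -> hdot Om (f x Om) = hdot Om (x Om)) ->
  M x -> hn (f x Om) = hn (x Om).
Proof.
move=> inv Mx; have [[bM _] _ _ mulM adjM] := cM.
have bx : bounded_op x by exact: bM. have bfx : bounded_op (f x) by exact/bM/endo_in.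
have E : hn (f x Om) ^+ 2 = hn (x Om) ^+ 2.
  apply: (@complexI K); rewrite -!hn_sqr adjE // [RHS]adjE // -endo_adj //.
  rewrite -[RHS](inv (adj x \o x)); last exact/mulM/Mx/adjM.
  by rewrite endo_comp //; exact: adjM.
by apply/eqP; rewrite -(@eqrXn2 _ 2) ?hn_ge0 // E.
Qed.

End StarEndo.

Section CuntzState.
Context {K : realType} {H : hilbertSpace K} {d : nat} (S : 'I_d -> H -> H).
Context (tau : (H -> H) -> K[i]) (Om : H) (lam : (H -> H) -> (H -> H) -> (H -> H)).
Hypotheses (hd : (0 < d)%N) (hS : cuntz_family S) (htau : normalized_trace S tau).
Hypothesis hlam : forall u : H -> H, unitary_op u -> Falg S u ->
  lambda_extension S Om u (lam u).
Hypothesis hgns : gns_vector S lam tau Om.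
Implicit Types (x y z : H -> H) (mu nu : seq 'I_d).

Let cM := vnM_cstar hS.
Let omega x := hdot Om (x Om).

Lemma gauge_extension t : lambda_extension S Om (cis t *: idfun) (gauge lam t).
Proof.
apply: hlam; last first.
  by apply: (wspan_Falg hS (n := 0)); apply: subspaceZ; [exact: wspan_subspace|exact: wspan_id].
have bi := @bounded_id K H.
have E : adj (cis t *: idfun : H -> H) = (cis t)^* *: idfun by rewrite adjZ // adj_id.
split; first exact: boundedZ.
  by rewrite E; apply/funext => xi; rewrite -[LHS]/(_ *: (_ *: xi)) scalerA cis_conjK scale1r.
by rewrite E; apply/funext => xi; rewrite -[LHS]/(_ *: (_ *: xi)) scalerA mulrC cis_conjK scale1r.
Qed.

Lemma gauge_endo t : star_endomorphism (vnM S) (gauge lam t).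
Proof. by case: (gauge_extension t). Qed.

Lemma gauge_state t x : vnM S x -> omega (gauge lam t x) = omega x.
Proof. by case: (gauge_extension t) => _ _ _ h _; exact: h. Qed.

Lemma gauge_S t i : gauge lam t (S i) = cis t *: S i.
Proof. by case: (gauge_extension t) => _ h _ _ _; rewrite h. Qed.

Local Notation spec := (spectral S lam).

Lemma spectral_subspace k : subspace (spec k).
Proof.
split.
  split=> [|t]; first by case: (vnM_subspace hS).
  by rewrite scaler0 (endo0 cM (gauge_endo t)).
move=> a x y [Mx hx] [My hy]; split=> [|t]; first by case: (vnM_subspace hS) => _; exact.
rewrite (endo_lin (gauge_endo t)) // hx hy scalerDr !scalerA.
by rewrite [a * _]mulrC.
Qed.

Lemma spectral_comp j k x y : spec j x -> spec k y -> spec (j + k) (x \o y).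
Proof.
move=> [Mx hx] [My hy]; split=> [|t]; first exact: vnM_mul.
rewrite (endo_comp (gauge_endo t)) // hx hy rmorphD mulrDr cisD.
have bx := vnM_bounded Mx.
by apply/funext => xi; rewrite -[LHS]/(_ *: x (_ *: y xi)) opZ // scalerA.
Qed.

Lemma spectral_adj k x : spec k x -> spec (- k) (adj x).
Proof.
move=> [Mx hx]; split=> [|t]; first exact: vnM_adj.
rewrite (endo_adj (gauge_endo t)) // hx adjZ ?cis_conj ?rmorphN ?mulrN //.
exact: vnM_bounded Mx.
Qed.

Lemma spectral_id : spec 0 idfun.
Proof.
split=> [|t]; first exact: vnM_id.
by rewrite (endo_id (gauge_endo t)) rmorph0 mulr0 cis0 scale1r.
Qed.

Lemma spectral_word mu : spec (size mu) (word S mu).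
Proof.
elim: mu => [|i mu IH]; first exact: spectral_id.
rewrite /= -add1n PoszD; apply: spectral_comp => //.
by split=> [|t]; [exact: vnM_S|rewrite gauge_S mulr1].
Qed.

Lemma wspan_spectral l m : wspan S l m `<=` spec (l%:Z - m%:Z).
Proof.
apply: wspan_ind; first exact: spectral_subspace.
move=> mu nu <- <-; apply: spectral_comp; first exact: spectral_word.
exact/spectral_adj/spectral_word.
Qed.

Lemma spectral_state k x : spec k x -> k != 0 -> omega x = 0.
Proof.
(* At [t = pi / k] the gauge automorphism multiplies [x] by [-1]. *)
move=> [Mx hx] k0; have := gauge_state (pi / k%:~R) Mx.
rewrite hx divfK ?intr_eq0 // cis_pi /omega.
rewrite -[(-1 *: x) Om]/(-1 *: x Om) hdotZr mulN1r => /eqP.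
by rewrite eq_sym -subr_eq0 opprK -mulr2n mulrn_eq0 /= => /eqP.
Qed.

(** The integrand defining [E0 lam x] is constant. *)
Lemma E0_spectral0 x : spec 0 x -> E0 lam x = x.
Proof.
move=> [Mx hx]; have bx := vnM_bounded Mx.
have gx t : gauge lam t x = x by rewrite hx rmorph0 mulr0 cis0 scale1r.
pose P := [set y : H -> H | bounded_op y /\ forall xi eta : H,
     hdot xi (y eta) = ((2 * pi)^-1)%:C *
       cintegral 0 (2 * pi) (fun t => hdot xi (gauge lam t x eta))].
have Px : P x.
  split=> // xi eta.
  have -> : (fun t => hdot xi (gauge lam t x eta)) = (fun=> hdot xi (x eta)).
    by apply/funext => t; rewrite gx.
  rewrite /cintegral !Rintegral_cst //.
  have p0 : (0 : K) < 2 * pi by rewrite mulr_gt0 // pi_gt0.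
  pose L : K := fine (lebesgue_measure (`[0, 2 * pi]%classic : set K)).
  have mE : L = 2 * pi.
    by rewrite /L lebesgue_measure_itv /= lte_fin p0 -EFinB subr0.
  rewrite -[RHS]/(_ * ((_ * L) +i* (_ * L))) mE.
  case: (hdot xi (x eta)) => a b /=.
  have pn0 : pi != 0 :> K := lt0r_neq0 (pi_gt0 K).
  move: (pi : K) pn0 => p pn0.
  by apply/eqP; rewrite eq_complex /=; apply/andP; split; apply/eqP; field.
have [by' Py] := xgetPex (0 : H -> H) (ex_intro _ x Px).
apply/funext => eta; apply: hdot_ext => xi; case: Px => _ Px; rewrite Px.
exact: Py.
Qed.

Lemma state_trace n x : wspan S n n x -> omega x = tau x.
Proof.
move=> wx; case: hgns => _ h; rewrite /omega h; last exact: (alg_cuntz hS (wspan_alg wx)).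
by rewrite E0_spectral0 //; have := wspan_spectral wx; rewrite subrr.
Qed.

Lemma state_id : hdot Om Om = 1.
Proof. by case: htau => _ _ t1 _; rewrite -t1; exact: (state_trace (wspan_id hS 0)). Qed.

(** * The KMS condition and its consequences *)

Local Notation D := (d%:R : K[i]).

Lemma D_neq0 : D != 0. Proof. by rewrite pnatr_eq0 -lt0n. Qed.

(** The trace property moves [S_mu S_nu^*] to every other matrix unit of the
    same size, so all diagonal units have the same trace and the others have
    trace zero. *)
Lemma trace_gen l mu nu : size mu = l -> size nu = l ->
  tau (word S mu \o adj (word S nu)) = if mu == nu then D ^- l else 0.
Proof.
case: htau => tlin _ t1 tcomm smu snu.
have FF be ga : size be = l -> size ga = l -> wspan S l l (word S be \o adj (word S ga)).
  by move=> <- E; rewrite -[X in wspan _ _ X]E; exact: wspan_gen.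
have FA be ga : size be = l -> size ga = l -> Falg S (word S be \o adj (word S ga)).
  by move=> sb sg; apply: (wspan_Falg hS (FF _ _ sb sg)).
have F0 : Falg S 0 by apply: (wspan_Falg hS (n := l)); case: (wspan_subspace S l l).
have t0 : tau 0 = 0.
  have := tlin (-1) 0 0 F0 F0; rewrite scaler0 add0r mulN1r => E.
  by rewrite E addNr.
have mulE al be ga de : size be = l -> size ga = l ->
    (word S al \o adj (word S be)) \o (word S ga \o adj (word S de)) =
    if be == ga then word S al \o adj (word S de) else 0.
  move=> sb sg.
  rewrite -[LHS]/(word S al \o (adj (word S be) \o word S ga) \o adj (word S de)).
  rewrite adj_word_word ?sb //; case: eqP => // _; apply: comp0r; exact: bounded_word.
have off be ga : size be = l -> size ga = l -> be != ga ->
    tau (word S be \o adj (word S ga)) = 0.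
  move=> sb sg ne; rewrite -[X in tau X](_ : (word S be \o adj (word S be)) \o
     (word S be \o adj (word S ga)) = _); last by rewrite mulE // eqxx.
  by rewrite tcomm ?mulE //; [rewrite eq_sym (negPf ne)|exact: FA|exact: FA].
have diag be : size be = l ->
    tau (word S be \o adj (word S be)) = tau (word S mu \o adj (word S mu)).
  move=> sb; rewrite -[X in tau X = _](_ : (word S be \o adj (word S mu)) \o
     (word S mu \o adj (word S be)) = _); last by rewrite mulE // eqxx.
  by rewrite tcomm ?mulE ?eqxx //; exact: FA.
case: eqP => [<-|/eqP ne]; last exact: off.
have tsum (s : seq (l.-tuple 'I_d)) :
    tau (\sum_(be <- s) (word S be \o adj (word S be))) =
    \sum_(be <- s) tau (word S be \o adj (word S be)).
  have Fs (s' : seq (l.-tuple 'I_d)) : Falg S (\sum_(be <- s') (word S be \o adj (word S be))).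
    apply: (wspan_Falg hS (n := l)); apply: subspace_sum; first exact: wspan_subspace.
    by move=> be _; apply: FF; rewrite size_tuple.
  elim: s => [|be s IH]; first by rewrite !big_nil.
  rewrite !big_cons -[X in tau (X + _)]scale1r tlin ?IH ?mul1r //.
  by apply: FA; rewrite size_tuple.
have := t1; rewrite -(sum_word_adj hS l) tsum.
rewrite (eq_bigr (fun=> tau (word S mu \o adj (word S mu)))) => [|be _]; last first.
  by apply: diag; rewrite size_tuple.
rewrite big_const iter_addr_0 card_tuple card_ord => E.
rewrite -mulr_natl natrX in E.
by rewrite -[LHS](mulKf (expf_neq0 l D_neq0)) E mulr1.
Qed.

Lemma state_gen mu nu :
  omega (word S mu \o adj (word S nu)) = if mu == nu then D ^- (size mu) else 0.
Proof.
have [sz|sz] := eqVneq (size mu) (size nu); last first.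
  case: eqP => [E|_]; first by rewrite E eqxx in sz.
  have := wspan_spectral (wspan_gen S mu nu).
  by move/spectral_state; apply; rewrite subr_eq0 eqz_nat.
have w : wspan S (size mu) (size mu) (word S mu \o adj (word S nu)).
  by rewrite [X in wspan _ _ X]sz; exact: wspan_gen.
by rewrite (state_trace w) (@trace_gen (size mu)).
Qed.

(** On words both sides are known from [state_gen], and the factor [d] is the
    ratio between the traces of matrix units of consecutive sizes. *)
Lemma kms_S i x : alg S x -> omega (x \o S i) = D * omega (S i \o x).
Proof.
have bSi := bounded_S hS i.
move: x; apply: alg_ind => [|l m].
  split; first by rewrite /omega /= op0 // !hdot0r mulr0.
  move=> a x y; rewrite /omega /= => hx hy.
  rewrite -[((a *: x + y) _)]/(a *: x (S i Om) + y (S i Om)).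
  rewrite -[((a *: x + y) _)]/(a *: x Om + y Om) op_lin // !hdotDr !hdotZr hx hy.
  by rewrite mulrDr mulrCA.
apply: wspan_ind.
  split; first by rewrite /omega /= op0 // !hdot0r mulr0.
  move=> a x y; rewrite /omega /= => hx hy.
  rewrite -[((a *: x + y) _)]/(a *: x (S i Om) + y (S i Om)).
  rewrite -[((a *: x + y) _)]/(a *: x Om + y Om) op_lin // !hdotDr !hdotZr hx hy.
  by rewrite mulrDr mulrCA.
move=> mu nu _ _.
rewrite -[S i \o (_ \o _)]/(word S (i :: mu) \o adj (word S nu)) state_gen.
case: nu => [|j nu].
  have -> : (word S mu \o adj (word S [::])) \o S i = word S (rcons mu i) \o adj (word S [::]).
    by rewrite /= adj_id word_rcons.
  by rewrite state_gen; case: mu => [|? ?]; rewrite mulr0.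
rewrite adj_word_cons //.
rewrite -[(_ \o _) \o S i]/(word S mu \o adj (word S nu) \o (adj (S j) \o S i)) adjS_S //.
rewrite eqseq_cons [i == j]eq_sym; case: eqP => _ /=; last first.
  by rewrite mulr0 /omega comp0r ?hdot0r //; exact: bounded_gen.
rewrite -[X in omega X]/(word S mu \o adj (word S nu)) state_gen.
case: eqP => _; last by rewrite mulr0.
by rewrite exprS invfM mulVKf ?D_neq0.
Qed.

Lemma alg_dense_Om : dense_set [set x Om | x in alg S].
Proof. by apply: alg_dense => //; case: hgns. Qed.

Lemma sqr_state x : bounded_op x -> (hn (x Om) ^+ 2)%:C = omega (adj x \o x).
Proof. by move=> bx; rewrite -hn_sqr adjE. Qed.

(** By [kms_S] the squared norms of the vectors [x (S j Om)] add up to [d] times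
    the squared norm of [x Om]. *)
Lemma right_mult_S_bound i x : alg S x -> hn (x (S i Om)) <= d%:R * hn (x Om).
Proof.
move=> ax; have bx := alg_bounded hS ax.
have bSi j := bounded_S hS j.
have sq j : (hn (x (S j Om)) ^+ 2)%:C = D * omega (S j \o adj (S j) \o (adj x \o x)).
  have bxS := bounded_comp bx (bSi j).
  transitivity (omega (adj (x \o S j) \o (x \o S j))); first exact: sqr_state bxS.
  rewrite (adj_comp bx (bSi j)).
  have ax' : alg S (adj (S j) \o (adj x \o x)).
    apply: alg_mul (alg_mul hS (alg_adj hS ax) ax) => //.
    exact: (alg_adj hS (alg_S S j)).
  exact: (kms_S j ax').
have sum : \sum_j hn (x (S j Om)) ^+ 2 = d%:R * hn (x Om) ^+ 2.
  apply: (@complexI K); rewrite rmorph_sum [RHS]rmorphM rmorph_nat /= (sqr_state bx).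
  under eq_bigr => j _ do rewrite sq.
  rewrite -mulr_sumr -hdot_sumr; congr (_ * hdot Om _).
  rewrite -[RHS]/((idfun \o (adj x \o x)) Om) -(sum_SadjS hS).
  by rewrite -[RHS]/((\sum_(j < d) (S j \o adj (S j))) ((adj x \o x) Om)) sum_opE.
rewrite -ler_sqr ?nnegrE ?mulr_ge0 ?hn_ge0 // exprMn.
apply: (@le_trans _ _ (d%:R * hn (x Om) ^+ 2)).
  by rewrite -sum (bigD1 i) //= lerDl sumr_ge0 // => j _; exact: sqr_ge0.
rewrite ler_wpM2r ?sqr_ge0 // expr2 ler_peMr // ?ler0n //.
by rewrite ler1n.
Qed.

Lemma right_mult_adjS_bound i x : alg S x -> hn (x (adj (S i) Om)) <= 1 * hn (x Om).
Proof.
move=> ax; have bx := alg_bounded hS ax; rewrite mul1r.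
have bSi := bounded_S hS i; have bSi' := bounded_adj bSi.
have E : d%:R * hn (x (adj (S i) Om)) ^+ 2 = hn (x Om) ^+ 2.
  apply: (@complexI K); rewrite [LHS]rmorphM rmorph_nat /= (sqr_state bx).
  have -> : (hn (x (adj (S i) Om)) ^+ 2)%:C =
      omega (adj (x \o adj (S i)) \o (x \o adj (S i))).
    exact: sqr_state (bounded_comp bx bSi').
  rewrite (adj_comp bx bSi') (adjK bSi).
  have aS' : alg S (adj (S i)) by apply: alg_adj (alg_S S i).
  have ax' := alg_mul hS (alg_mul hS (alg_adj hS ax) ax) aS'.
  have := kms_S i ax'.
  rewrite -[(_ \o adj (S i)) \o S i]/((adj x \o x) \o (adj (S i) \o S i)).
  by rewrite (adjS_S hS) eqxx => /esym.
rewrite -ler_sqr ?nnegrE ?hn_ge0 // -E ler_peMl ?sqr_ge0 //.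
by rewrite ler1n.
Qed.

Lemma right_mult_extends c (C : K) : alg S c -> 0 <= C ->
  (forall x, alg S x -> hn (x (c Om)) <= C * hn (x Om)) ->
  exists2 T, commutant (cuntz_alg S) T & T Om = c Om.
Proof.
move=> ac C0 hC; have aS := alg_subspace S.
pose G (p q : H) := exists2 x, alg S x & p = x Om /\ q = x (c Om).
have [||||T bT TG] := @extension _ _ G C _ _ C0.
- by exists 0; [case: aS|].
- move=> a _ _ _ _ [x ax [-> ->]] [y ay [-> ->]]; exists (a *: x + y) => //.
  by case: aS => _; exact.
- by move=> _ _ [x ax [-> ->]]; exact: hC.
- move=> xi e e0; have [_ [x ax <-] l] := alg_dense_Om xi e0.
  by exists (x Om) => //; exists (x (c Om)), x.
have TE x : alg S x -> T (x Om) = x (c Om) by move=> ax; apply: TG; exists x.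
exists T; last by have := TE idfun (alg_id hS).
have comm y : alg S y -> T \o y = y \o T.
  move=> ay; have bY := alg_bounded hS ay.
  apply: (dense_eq alg_dense_Om); [exact: bounded_comp|exact: bounded_comp|].
  move=> _ [x ax <-]; rewrite /= TE // (TE (y \o x)) //; exact: alg_mul.
apply: cuntz_commutant => // i; apply: comm; first exact: alg_S.
exact: (alg_adj hS (alg_S S i)).
Qed.

(** Right multiplication by [c] sends [x Om] to [x c Om] and commutes with
    left multiplications; it is the operator [T]. *)
Lemma right_mult c : alg S c -> exists2 T, commutant (cuntz_alg S) T & T Om = c Om.
Proof.
have sub : subspace [set c : H -> H | exists2 T, commutant (cuntz_alg S) T & T Om = c Om].
  have cC : cstar_subalgebra (commutant (cuntz_alg S)).
    by have [[bC _] _ _ _ aC] := cuntz_cstar hS; exact: commutant_cstar.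
  split; first by exists 0 => //; case: (cstar_subspace cC).
  move=> a x y [T TC TE] [U UC UE]; exists (a *: T + U).
    by case: (cstar_subspace cC) => _; exact.
  by rewrite -[LHS]/(a *: T Om + U Om) TE UE.
have mulT x y : alg S x -> (exists2 T, commutant (cuntz_alg S) T & T Om = x Om) ->
    (exists2 T, commutant (cuntz_alg S) T & T Om = y Om) ->
    exists2 T, commutant (cuntz_alg S) T & T Om = (x \o y) Om.
  move=> ax [T TC TE] [U [bU UC] UE]; have [bT TC'] := TC.
  exists (U \o T).
    split=> [|z cz]; first exact: bounded_comp.
    by rewrite -[LHS]/(U \o (T \o z)) TC' // -[LHS]/((U \o z) \o T) UC.
  rewrite /= TE -UE; exact: (congr1 (@^~ Om) (UC _ (alg_cuntz hS ax))).
have rid : exists2 T, commutant (cuntz_alg S) T & T Om = (idfun : H -> H) Om.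
  by exists idfun => //; split=> //; exact: bounded_id.
have rS i : exists2 T, commutant (cuntz_alg S) T & T Om = S i Om.
  apply: (@right_mult_extends _ d%:R) => //; first exact: alg_S.
  by move=> x; exact: right_mult_S_bound.
have rS' i : exists2 T, commutant (cuntz_alg S) T & T Om = adj (S i) Om.
  apply: (@right_mult_extends _ 1) => //; first exact: (alg_adj hS (alg_S S i)).
  by move=> x; exact: right_mult_adjS_bound.
move: c; apply: alg_ind => // l m; apply: wspan_ind => // mu nu _ _.
apply: (mulT _ _ (alg_word S mu)).
  elim: mu => [|i mu IH]; first exact: rid.
  exact: (mulT (S i) (word S mu) (alg_S S i) (rS i) IH).
elim/last_ind: nu => [|nu i IH]; first by rewrite /= adj_id.
rewrite adj_word_rcons //; exact: (mulT _ _ (alg_adj hS (alg_S S i)) (rS' i) IH).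
Qed.

(** The commutant sends [Om] to a dense set of vectors by [right_mult], and
    [x T Om = T x Om] for [T] in the commutant. *)
Lemma separating x y : vnM S x -> vnM S y -> x Om = y Om -> x = y.
Proof.
move=> Mx My E; apply: (dense_eq alg_dense_Om (vnM_bounded Mx) (vnM_bounded My)) => _ [c ac <-].
have [T TC TE] := right_mult ac.
rewrite -TE; have := vnM_commutant Mx TC; have := vnM_commutant My TC.
move=> /(congr1 (@^~ Om)) /= -> /(congr1 (@^~ Om)) /= ->.
by rewrite E.
Qed.

(** Both sides are inner products of [x Om] with fixed vectors, by [right_mult],
    so it is enough to compare them when [x] is a sum of words. *)
Lemma kms_extend c c' (s : K[i]) : alg S c -> alg S c' ->
  (forall x, alg S x -> omega (x \o c) = s * omega (c' \o x)) ->
  forall x, vnM S x -> omega (x \o c) = s * omega (c' \o x).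
Proof.
move=> ac ac' h x Mx; have [T TC TE] := right_mult ac; have [bT _] := TC.
have bc' := alg_bounded hS ac'.
pose v := adj T Om - (s^* *: adj c' Om).
have vE y : vnM S y -> hdot v (y Om) = omega (y \o c) - s * omega (c' \o y).
  move=> My; rewrite hdotBl hdotZl conjCK /omega /= -!adjEr // -TE.
  by have /(congr1 (@^~ Om)) /= -> := vnM_commutant My TC.
suff v0 : v = 0 by apply/eqP; rewrite -subr_eq0 -vE // v0 hdot0l.
apply: (dense_orth alg_dense_Om) => _ [y ay <-]; apply: hdot_sym0.
by rewrite vE ?h ?subrr //; exact: alg_vnM.
Qed.

Lemma kms_M i x : vnM S x -> omega (x \o S i) = D * omega (S i \o x).
Proof. by move: x; apply: kms_extend; [exact: alg_S|exact: alg_S|exact: kms_S]. Qed.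

Lemma kms_adj_M i x : vnM S x -> omega (x \o adj (S i)) = D^-1 * omega (adj (S i) \o x).
Proof.
have aS : alg S (adj (S i)) by exact: (alg_adj hS (alg_S S i)).
move=> Mx; have MS' : vnM S (adj (S i)) by exact: alg_vnM.
have conj y : vnM S y -> omega (adj y) = (omega y)^*.
  by move=> My; rewrite /omega -(adjE _ _ (vnM_bounded My)) [LHS]hdot_conj.
have bx := vnM_bounded Mx; have bSi := bounded_S hS i; have bSi' := bounded_adj bSi.
have My : vnM S (adj x) by exact: vnM_adj.
have E1 : adj (adj (S i) \o x) = adj x \o S i by rewrite (adj_comp bSi' bx) (adjK bSi).
have E2 : adj (x \o adj (S i)) = S i \o adj x by rewrite (adj_comp bx bSi') (adjK bSi).
have := kms_M i My; rewrite -E1 -E2 !conj; [|exact: vnM_mul|exact: vnM_mul].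
move=> /(congr1 Num.conj); rewrite rmorphM rmorph_nat /= !conjCK => ->.
by rewrite mulKf ?D_neq0.
Qed.

(** Moving [S_mu] and [S_nu^*] around [x] produces the factors [d ^ n] and
    [d ^ - n]. *)
Lemma centralizer n u x : wspan S n n u -> vnM S x -> omega (x \o u) = omega (u \o x).
Proof.
move=> wu Mx; have bx := vnM_bounded Mx; move: u wu; apply: wspan_ind.
  split; first by rewrite /omega /= op0.
  move=> a u v; rewrite /omega /= => hu hv.
  rewrite -[((a *: u + v) _)]/(a *: u Om + v Om) op_lin //.
  rewrite -[((a *: u + v) _)]/(a *: u (x Om) + v (x Om)).
  by rewrite !hdotDr !hdotZr hu hv.
have Mw al : vnM S (word S al) by apply: alg_vnM => //; exact: alg_word.
have kw al y : vnM S y -> omega (y \o word S al) = D ^+ size al * omega (word S al \o y).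
  elim: al y => [|i al IH] y My; first by rewrite mul1r.
  rewrite -[y \o _]/((y \o S i) \o word S al) IH; last by apply: vnM_mul => //; exact: vnM_S.
  rewrite -[word S al \o (y \o S i)]/((word S al \o y) \o S i) kms_M; last exact: vnM_mul.
  by rewrite mulrA -exprSr.
have kw' al y : vnM S y ->
    omega (y \o adj (word S al)) = D ^- size al * omega (adj (word S al) \o y).
  elim/last_ind: al y => [|al i IH] y My; first by rewrite invr1 mul1r /= adj_id.
  have MS' : vnM S (adj (S i)) by apply: vnM_adj => //; exact: vnM_S.
  rewrite adj_word_rcons // -[y \o _]/((y \o adj (S i)) \o adj (word S al)) IH; last exact: vnM_mul.
  rewrite -[adj (word S al) \o (y \o _)]/((adj (word S al) \o y) \o adj (S i)) kms_adj_M.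
    by rewrite mulrA -invfM -exprSr size_rcons.
  by apply: vnM_mul => //; exact: vnM_adj.
move=> mu nu smu snu.
have Mw' : vnM S (adj (word S nu)) by exact: vnM_adj.
rewrite -[x \o _]/((x \o word S mu) \o adj (word S nu)) kw'; last exact: vnM_mul.
rewrite -[adj (word S nu) \o _]/((adj (word S nu) \o x) \o word S mu) kw; last exact: vnM_mul.
by rewrite smu snu mulKf // expf_neq0 ?D_neq0.
Qed.

(** The gauge action is implemented by operators that fix [Om] and commute with
    words of degree zero, hence commute with [vnN S]. *)
Lemma vnN_spectral0 x : vnN S x -> spec 0 x.
Proof.
move=> Nx; have Mx := vnN_vnM hS Nx; split=> // t.
rewrite rmorph0 mulr0 cis0 scale1r; have sg := gauge_endo t.
pose G (p q : H) := exists2 y, vnM S y & p = y Om /\ q = gauge lam t y Om.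
have [||||U bU UG] := @extension _ _ G 1 _ _ ler01.
- by exists 0; [case: (vnM_subspace hS)|rewrite (endo0 cM sg)].
- move=> a _ _ _ _ [y My [-> ->]] [z Mz [-> ->]]; exists (a *: y + z).
    by case: (vnM_subspace hS) => _; exact.
  by rewrite (endo_lin sg).
- move=> _ _ [y My [-> ->]]; rewrite mul1r.
  by rewrite (endo_isometry cM sg _ My) // => z Mz; exact: gauge_state.
- move=> xi e e0; have [_ [y ay <-] l] := alg_dense_Om xi e0.
  by exists (y Om) => //; exists (gauge lam t y Om), y => //; exact: alg_vnM.
have UE y : vnM S y -> U (y Om) = gauge lam t y Om by move=> My; apply: UG; exists y.
have UOm : U Om = Om by have := UE idfun (vnM_id hS); rewrite (endo_id sg).
have UF m y : wspan S m m y -> y \o U = U \o y.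
  move=> wy; have bY := wspan_bounded hS wy; have My := wspan_vnM hS wy.
  have [_ gy] := wspan_spectral wy.
  apply: (dense_eq alg_dense_Om); [exact: bounded_comp|exact: bounded_comp|].
  move=> _ [z az <-]; have Mz := alg_vnM hS az.
  rewrite /= UE // (UE (y \o z)); last exact: vnM_mul.
  by rewrite (endo_comp sg) // gy subrr rmorph0 mulr0 cis0 scale1r.
have UFalg : commutant (Falg S) U.
  have bX : [set U] `<=` bounded_op by move=> _ ->.
  split=> // y Fy; suff : commutant [set U] y by case=> _ /(_ U erefl) ->.
  apply: (commutant_closed bX).
  move: y Fy; apply: norm_closureS => y [m _ wy]; split.
    exact: (wspan_bounded hS (wy : wspan S m m y)).
  by move=> _ ->; exact: (@UF m).
have comm : x \o U = U \o x by case: Nx => _; exact.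
apply: separating => //; first exact: (endo_in sg).
by rewrite -UE // -{2}UOm; exact: (congr1 (@^~ Om) (esym comm)).
Qed.

(** The vectors [S_mu S_nu^* Om] are orthogonal and have squared norm [d ^- m],
    which gives the coefficients of the orthogonal projection. *)
Lemma wspan_projection l m xi : exists2 e, wspan S l m e &
  forall w, wspan S l m w -> hdot (w Om) (xi - e Om) = 0.
Proof.
pose g (p : l.-tuple 'I_d) (q : m.-tuple 'I_d) := word S p \o adj (word S q).
have gg p q p' q' : hdot (g p q Om) (g p' q' Om) =
    if (p == p') && (q == q') then D ^- m else 0.
  rewrite adjE; last exact: bounded_gen.
  rewrite (adj_gen hS).
  rewrite -[X in hdot _ X]/((word S q \o (adj (word S p) \o word S p') \o adj (word S q')) Om).
  rewrite (adj_word_word hS) ?size_tuple // -[(_ : seq _) == _]/(p == p'); case: eqP => _ /=.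
    rewrite -[X in hdot _ X]/((word S q \o adj (word S q')) Om).
    by rewrite [LHS]state_gen -[(_ : seq _) == _]/(q == q') size_tuple.
  by rewrite op0 ?hdot0r //; exact: bounded_word.
pose e := \sum_p \sum_q (D ^+ m * hdot (g p q Om) xi) *: g p q.
have we : wspan S l m e by exists (fun p q => D ^+ m * hdot (g p q Om) xi).
exists e => // w [c ->].
have ge p q : hdot (g p q Om) (e Om) = hdot (g p q Om) xi.
  rewrite /e pair_bigA sum_opE hdot_sumr (bigD1 (p, q)) //=.
  rewrite [X in _ + X]big1 => [|[p' q']]; last first.
    rewrite xpair_eqE /= [p' == p]eq_sym [q' == q]eq_sym => /negPf ne.
    by rewrite -[X in hdot _ X]/(_ *: g p' q' Om) hdotZr gg ne mulr0.
  rewrite addr0 -[X in hdot _ X]/(_ *: g p q Om) hdotZr gg !eqxx mulrAC.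
  by rewrite mulfV ?mul1r // expf_neq0 ?D_neq0.
apply: hdot_sym0; rewrite sum_opE hdot_sumr big1 // => p _.
rewrite sum_opE hdot_sumr big1 // => q _.
rewrite -[X in hdot _ X]/(_ *: g p q Om) hdotZr hdot_conj hdotBr ge subrr.
by rewrite rmorph0 mulr0.
Qed.

(** * Fixed points of theta *)

Section Theta.
Hypothesis hd2 : (1 < d)%N.
Context (n : nat) (u : H -> H).
Hypotheses (uu : unitary_op u) (wu : wspan S n.+1 n.+1 u).
Let theta := Ad u \o phi S.

Let bu : bounded_op u. Proof. by case: uu. Qed.
Let bu' : bounded_op (adj u). Proof. exact: bounded_adj. Qed.
Let wu' : wspan S n.+1 n.+1 (adj u). Proof. exact: wspan_adj. Qed.
Let Mu : vnM S u. Proof. exact: wspan_vnM wu. Qed.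
Let Mu' : vnM S (adj u). Proof. exact: vnM_adj. Qed.
Let u'u : adj u \o u = idfun. Proof. by case: uu. Qed.
Let uu' : u \o adj u = idfun. Proof. by case: uu. Qed.

Lemma theta_lin a x y : theta (a *: x + y) = a *: theta x + theta y.
Proof.
rewrite /theta /= phi_lin //; apply/funext => xi; exact: (op_lin a _ _ bu).
Qed.

Lemma theta0 : theta 0 = 0.
Proof. by have := theta_lin (-1) 0 0; rewrite scaler0 add0r scaleN1r addNr. Qed.

Lemma theta_comp x y : bounded_op x -> bounded_op y -> theta (x \o y) = theta x \o theta y.
Proof.
move=> bx bY; rewrite /theta /= phi_comp //.
rewrite -[RHS]/(u \o phi S x \o (adj u \o u) \o phi S y \o adj u) u'u //.
Qed.

Lemma theta_adj x : bounded_op x -> theta (adj x) = adj (theta x).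
Proof.
move=> bx; have bp := bounded_phi hS bx; rewrite /theta /= phi_adj // /Ad.
rewrite (adj_comp (bounded_comp bu bp) bu') (adj_comp bu bp) (adjK bu) //.
Qed.

Lemma theta_M x : vnM S x -> vnM S (theta x).
Proof.
by move=> Mx; apply: vnM_mul => //; apply: vnM_mul => //; exact: vnM_phi.
Qed.

Lemma state_sum (F : 'I_d -> H -> H) : omega (\sum_i F i) = \sum_i omega (F i).
Proof. by rewrite /omega sum_opE hdot_sumr. Qed.

Lemma state_theta x : vnM S x -> omega (theta x) = omega x.
Proof.
move=> Mx; have bx := vnM_bounded Mx.
rewrite (@centralizer n.+1 (adj u) (u \o phi S x)) //; last first.
  by apply: vnM_mul => //; exact: vnM_phi.
rewrite -[X in omega X]/((adj u \o u) \o phi S x) u'u.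
rewrite -[X in omega X]/(phi S x) [LHS]state_sum.
have E i : omega (S i \o x \o adj (S i)) = D^-1 * omega x.
  rewrite kms_adj_M; last by apply: vnM_mul => //; exact: vnM_S.
  by rewrite -[adj (S i) \o _]/((adj (S i) \o S i) \o x) (adjS_S hS) eqxx.
rewrite (eq_bigr _ (fun i _ => E i)) sumr_const card_ord -mulrnAl.
by rewrite -[D^-1 *+ d]mulr_natl mulfV ?D_neq0 // mul1r.
Qed.

Lemma hn_theta x : vnM S x -> hn (theta x Om) = hn (x Om).
Proof.
move=> Mx; have bx := vnM_bounded Mx; have Mt := theta_M Mx.
have E : hn (theta x Om) ^+ 2 = hn (x Om) ^+ 2.
  apply: (@complexI K); rewrite (sqr_state (vnM_bounded Mt)) (sqr_state bx).
  rewrite -(theta_adj bx) -theta_comp //; last exact: bounded_adj.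
  by apply: state_theta; apply: vnM_mul => //; exact: vnM_adj.
by apply/eqP; rewrite -(@eqrXn2 _ 2) ?hn_ge0 // E.
Qed.

(** By KMS, pairing [y Om] with [theta z Om] amounts to pairing [z Om] with
    the average over [i] of [S_i^* u^* y u S_i Om], where the words are shorter
    by one letter on both sides. *)
Lemma theta_orth l m z : (n <= l)%N -> (n <= m)%N -> vnM S z ->
  (forall w, wspan S l m w -> hdot (w Om) (z Om) = 0) ->
  forall y, wspan S l.+1 m.+1 y -> hdot (y Om) (theta z Om) = 0.
Proof.
move=> nl nm Mz orth y wy; have bY := wspan_bounded hS wy.
have bz := vnM_bounded Mz.
have up k v : (n <= k)%N -> wspan S n.+1 n.+1 v -> wspan S k.+1 k.+1 v.
  by move=> nk wv; have := wspan_up hS (k - n) wv; rewrite addSn subnKC.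
pose y' := adj u \o adj y \o u.
have wy' : wspan S m.+1 l.+1 y'.
  apply: (wspan_mul hS _ (up _ _ nl wu)); apply: (wspan_mul hS (up _ _ nm wu')).
  exact: wspan_adj.
have My' := wspan_vnM hS wy'.
rewrite adjE // -[hdot _ _]/(omega ((adj y \o u \o phi S z) \o adj u)).
rewrite (@centralizer n.+1) //; last first.
  apply: vnM_mul => //; last exact: vnM_phi.
  by apply: vnM_mul => //; apply: vnM_adj => //; exact: wspan_vnM wy.
rewrite -[X in omega X]/(y' \o phi S z) /phi comp_sumr; last exact: (vnM_bounded My').
rewrite state_sum big1 // => i _.
rewrite -[X in omega X]/((y' \o S i \o z) \o adj (S i)) kms_adj_M; last first.
  by apply: vnM_mul => //; apply: vnM_mul => //; exact: vnM_S.
have wv : wspan S m l (adj (S i) \o y' \o S i).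
  by apply: wspan_Sr => //; exact: wspan_adjSl.
have := orth _ (wspan_adj hS wv); rewrite -adjEr; last exact: (wspan_bounded hS wv).
move=> E; rewrite -[omega _]/(hdot Om ((adj (S i) \o y' \o S i) (z Om))) E.
by rewrite mulr0.
Qed.

(** Let [e] be the compression of [x] to words of lengths [l] and [m].  Then
    [theta e] is the compression to the larger space of words of lengths [l + 1]
    and [m + 1], and has the same norm.  So both compressions agree. *)
Lemma fixed_truncation l m x : (n <= l)%N -> (n <= m)%N -> vnM S x -> theta x = x ->
  exists e, [/\ wspan S l m e, theta e = e &
    forall j w, wspan S (l + j) (m + j) w -> hdot (w Om) (x Om - e Om) = 0].
Proof.
move=> nl nm Mx fx; have [e we orth] := wspan_projection l m (x Om).
have Me := wspan_vnM hS we.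
have MB y z : vnM S y -> vnM S z -> vnM S (y - z).
  by move=> My Mz; apply: subspaceB My Mz; exact: vnM_subspace.
have thB y z : theta (y - z) = theta y - theta z.
  by rewrite addrC -scaleN1r theta_lin scaleN1r addrC.
have step j z : (forall w, wspan S (l + j) (m + j) w -> hdot (w Om) (x Om - z Om) = 0) ->
    vnM S z ->
    forall w, wspan S (l + j).+1 (m + j).+1 w -> hdot (w Om) (x Om - theta z Om) = 0.
  move=> h Mz w ww; rewrite -[x Om - _]/((x - theta z) Om) -{1}fx -thB.
  apply: (@theta_orth (l + j) (m + j)) => //; [exact: leq_trans (leq_addr _ _)|
    exact: leq_trans (leq_addr _ _)|exact: MB].
have orth0 w : wspan S (l + 0) (m + 0) w -> hdot (w Om) (x Om - e Om) = 0.
  by rewrite !addn0; exact: orth.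
have orth1 := step 0%N e orth0 Me; rewrite !addn0 in orth1.
have ee : hdot (e Om) (theta e Om - e Om) = 0.
  have -> : theta e Om - e Om = (x Om - e Om) - (x Om - theta e Om).
    by rewrite opprB [RHS]addrC addrA subrK.
  by rewrite hdotBr orth // orth1 ?subrr //; exact: wspan_succ.
have fe : theta e = e.
  apply: separating => //; first exact: theta_M.
  apply/eqP; rewrite -subr_eq0; apply/eqP/hn_eq0/eqP; rewrite -sqrf_eq0; apply/eqP.
  have := pythagoras ee; rewrite addrC subrK hn_theta //.
  by rewrite -[LHS]addr0 => /addrI.
exists e; split=> //; elim=> [//|j IH] w.
by rewrite !addnS -{1}fe; exact: step IH Me w.
Qed.

Lemma fixed_wspan l m j x : (n <= l)%N -> (n <= m)%N -> theta x = x ->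
  wspan S (l + j) (m + j) x -> wspan S l m x.
Proof.
move=> nl nm fx wx; have Mx := wspan_vnM hS wx.
have [e [we fe orth]] := fixed_truncation nl nm Mx fx.
suff -> : x = e by [].
apply: separating => //; first exact: wspan_vnM we.
apply/eqP; rewrite -subr_eq0; apply/eqP/hdot_eq0.
apply: (orth j (x - e)); apply: subspaceB => //; first exact: wspan_subspace.
exact: wspan_up.
Qed.


Lemma wspan_r0 l y : wspan S l 0 y ->
  exists a : l.-tuple 'I_d -> K[i], y = \sum_p a p *: word S p.
Proof.
move=> [c ->]; exists (fun p => c p [tuple]); apply: eq_bigr => p _.
rewrite (big_pred1 [tuple]) => [|q]; first by rewrite /= adj_id.
by rewrite /= [q]tuple0; apply/esym/eqP.
Qed.

Lemma adj_comp_eq0 x : bounded_op x -> adj x \o x = 0 -> x = 0.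
Proof.
move=> bx E; apply/funext => xi; apply: hdot_eq0.
by rewrite (adjE _ _ bx) -[adj x _]/((adj x \o x) xi) E hdot0r.
Qed.

Lemma eq0_words l x : bounded_op x ->
  (forall p : l.-tuple 'I_d, x \o word S p = 0) -> x = 0.
Proof.
move=> bx h; rewrite -[x]/(x \o idfun) -(sum_word_adj hS l) comp_sumr // big1 // => p _.
by rewrite -[LHS]/((x \o word S p) \o adj (word S p)) h.
Qed.

(** Write [e] as left multiplication from words of length [n] to words of length
    [n + k].  As [e e^*] is fixed of degree zero it lies in [F_d^n], so its range
    on the words of length [n + k] contains a copy of all words of length [k]:
    this forces [d ^ k <= d ^ n], and for [k = n] that [e] is injective. *)
Lemma fixed_rank k e : (n <= k)%N -> theta e = e -> wspan S (n + k) n e -> e <> 0 ->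
  (k <= n)%N /\ (k = n -> forall z, wspan S n 0 z -> e \o z = 0 -> z = 0).
Proof.
move=> nk fe we e0; have be := wspan_bounded hS we; have be' := bounded_adj be.
have we' := wspan_adj hS we.
pose c := e \o adj e.
have bc : bounded_op c := bounded_comp be be'.
have fc : theta c = c by rewrite theta_comp // theta_adj // fe.
have wc : wspan S n n c.
  by apply: (@fixed_wspan _ _ k) => //; exact: wspan_mul we we'.
have c0 : c <> 0.
  move=> E; apply: e0; rewrite -(adjK be).
  by rewrite [adj e]adj_comp_eq0 ?adj0 // adjK.
have [p zn0] : exists p : n.-tuple 'I_d, c \o word S p <> 0.
  apply: contrapT => no; apply: c0; apply: (@eq0_words n) => // p.
  by apply: contrapT => h; apply: no; exists p.
set z := c \o word S p in zn0.
have wz : wspan S n 0 z.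
  by apply: (wspan_mul hS wc); have := wspan_word S p; rewrite size_tuple.
have bz := wspan_bounded hS wz.
have [s sE] : exists s, adj z \o z = s *: idfun.
  have [a ->] := wspan_r0 (wspan_mul hS (wspan_adj hS wz) wz).
  exists (a [tuple]); rewrite (big_pred1 [tuple]) // => q.
  by rewrite /= [q]tuple0; apply/esym/eqP.
have s0 : s != 0.
  by apply/eqP => s0; apply: zn0; apply: adj_comp_eq0 => //; rewrite sE s0 scale0r.
pose y (b : k.-tuple 'I_d) := adj e \o (word S p \o word S b).
have wy b : wspan S n 0 (y b).
  apply: (wspan_mul hS we'); rewrite -word_cat.
  by have := wspan_word S (p ++ b); rewrite size_cat !size_tuple.
have [a aE] := choice (fun b => wspan_r0 (wy b)).
have comb (v : k.-tuple 'I_d -> K[i]) :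
    \sum_b v b *: y b = \sum_q (\sum_b v b * a b q) *: word S q.
  under eq_bigr => b _ do rewrite aE scaler_sumr.
  rewrite exchange_big; apply: eq_bigr => q _; rewrite scaler_suml.
  by apply: eq_bigr => b _; rewrite scalerA.
have ecomb (v : k.-tuple 'I_d -> K[i]) :
    e \o (\sum_b v b *: y b) = z \o (\sum_b v b *: word S b).
  rewrite !comp_sumr //; apply: eq_bigr => b _.
  by rewrite compZr // compZr.
have free (v : k.-tuple 'I_d -> K[i]) : e \o (\sum_b v b *: y b) = 0 -> forall b, v b = 0.
  move=> E b; have : adj (word S b) \o (adj z \o (e \o (\sum_b v b *: y b))) = 0.
    by rewrite E (comp0r (bounded_adj bz)) (comp0r (bounded_adj (bounded_word hS b))).
  rewrite ecomb -[_ \o (_ \o _)]/(adj (word S b) \o ((adj z \o z) \o _)) sE.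
  have bw := bounded_adj (bounded_word hS b).
  rewrite -[_ \o _]/(adj (word S b) \o (s *: (\sum_b v b *: word S b))) compZr // comp_sumr //.
  rewrite (bigD1 b) //= big1 => [|b' nb]; last first.
    rewrite compZr // adj_word_word ?size_tuple // -[(_ : seq _) == _]/(b == b').
    by rewrite eq_sym (negPf nb) scaler0.
  rewrite addr0 compZr // adj_word_word // eqxx scalerA.
  move=> /(congr1 (fun f : H -> H => hdot Om (f Om))).
  rewrite -[(_ *: _) Om]/(_ *: Om) hdotZr state_id mulr1 hdot0r => /eqP.
  by rewrite mulf_eq0 (negPf s0) => /eqP.
have [|le full] := @independent_family _ _ _ a.
  move=> v h; apply: free; rewrite comb big1 ?comp0r // => q _.
  by rewrite h scale0r.
split; first by rewrite !card_tuple !card_ord leq_exp2l in le.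
move=> kn w ww ew.
have [cw wE] := wspan_r0 ww.
have [|v vE] := full _ cw; first by rewrite !card_tuple kn.
have wy' : w = \sum_b v b *: y b.
  by rewrite wE comb; apply: eq_bigr => q _; rewrite vE.
rewrite wy' big1 // => b _; rewrite (free v) ?scale0r //.
by rewrite -wy'.
Qed.

(** Degree [k >= n] cannot occur: if [k = n], then [e] is injective on words of
    length [n], so [e \o e] is a nonzero fixed point of degree [2 * n]. *)
Lemma fixed_high_degree k e : (0 < n)%N -> (n <= k)%N -> theta e = e ->
  wspan S (n + k) n e -> e = 0.
Proof.
move=> n0 nk fe we; apply: contrapT => e0.
have be := wspan_bounded hS we; have be' := bounded_adj be.
have [kn inj] := fixed_rank nk fe we e0.
have {kn nk}kn : k = n by apply/eqP; rewrite eqn_leq kn nk.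
subst k.
have ee0 : e \o e = 0.
  apply: contrapT => ne; have [||||le _] := @fixed_rank (n + n) (e \o e) => //.
  - by rewrite leq_addr.
  - by rewrite theta_comp // fe.
  - by apply: (wspan_mul hS _ we); rewrite addnA; exact: wspan_up.
  by move: le; rewrite leqNgt -[X in (X < _)%N]addn0 ltn_add2l n0.
apply: e0; rewrite -(adjK be) [adj e]adj_comp_eq0 ?adj0 // adjK //.
pose c := e \o adj e.
have bc : bounded_op c := bounded_comp be be'.
have fc : theta c = c by rewrite theta_comp // theta_adj // fe.
have wc : wspan S n n c.
  by apply: (@fixed_wspan _ _ n) => //; exact: wspan_mul we (wspan_adj hS we).
apply: (@eq0_words n) => // p; apply: (inj erefl).
  by apply: (wspan_mul hS wc); have := wspan_word S p; rewrite size_tuple.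
by rewrite -[LHS]/((e \o e) \o (adj e \o word S p)) ee0.
Qed.

Lemma fixed_low_degree k e : (0 < n)%N -> (n <= k)%N -> theta e = e ->
  wspan S n (n + k) e -> e = 0.
Proof.
move=> n0 nk fe we; have be := wspan_bounded hS we.
rewrite -(adjK be) (@fixed_high_degree k (adj e)) ?adj0 //; last exact: wspan_adj.
by rewrite theta_adj // fe.
Qed.

Definition degrees := [seq - n%:Z + i%:Z | i <- index_iota 1 (2 * n)].

Lemma mem_degrees k : (k \in degrees) = (`|k| < n)%N.
Proof.
apply/mapP/idP => [[i ]|kn]; first by rewrite mem_index_iota => ? ->; lia.
by exists (absz (n%:Z + k)); [rewrite mem_index_iota|]; lia.
Qed.

Lemma uniq_degrees : uniq degrees.
Proof. by rewrite map_inj_uniq ?iota_uniq // => i j; lia. Qed.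

(** In degree [k] the words [S_mu S_nu^*] are normalized so that the shorter one
    of [mu] and [nu] has length [n]. *)
Let rowlen (k : int) := if 0 <= k then (n + `|k|)%N else n.
Let collen (k : int) := if 0 <= k then n else (n + `|k|)%N.

Lemma len_degree k : (rowlen k)%:Z - (collen k)%:Z = k.
Proof. by rewrite /rowlen /collen; case: ifP; lia. Qed.

(** Subtracting the truncations of all degrees leaves a vector orthogonal to all
    words, because words of different degrees are orthogonal. *)
Lemma fixed_decomposition x : (0 < n)%N -> vnM S x -> theta x = x ->
  exists2 e : int -> H -> H,
    forall k, wspan S (rowlen k) (collen k) (e k) /\ theta (e k) = e k &
    x = \sum_(k <- degrees) e k.
Proof.
move=> n0 Mx fx.
have ex k : exists e, [/\ wspan S (rowlen k) (collen k) e, theta e = e &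
    forall j w, wspan S (rowlen k + j) (collen k + j) w -> hdot (w Om) (x Om - e Om) = 0].
  by apply: fixed_truncation => //; rewrite /rowlen /collen; case: ifP => _ //; exact: leq_addr.
have [e eP] := choice ex.
have we k : wspan S (rowlen k) (collen k) (e k) by case: (eP k).
have fe k : theta (e k) = e k by case: (eP k).
have e0 k : k \notin degrees -> e k = 0.
  rewrite mem_degrees -leqNgt => nk; have := we k; rewrite /rowlen /collen.
  case: ifP => _ w; first exact: (fixed_high_degree n0 nk).
  exact: (fixed_low_degree n0 nk).
exists e => [k|]; first by [].
have Me k : vnM S (e k) := wspan_vnM hS (we k).
apply: separating => //.
  exact: (@subspace_sum K (H -> H) (vnM S) int degrees xpredT e (vnM_subspace hS)
    (fun k _ => Me k)).
apply/eqP; rewrite -subr_eq0; apply/eqP; apply: (dense_orth alg_dense_Om) => _ [w aw <-].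
have sub : subspace [set w : H -> H | hdot (w Om) (x Om - (\sum_(k <- degrees) e k) Om) = 0].
  split; first exact: hdot0l.
  by move=> a v w' hv hw /=; rewrite hdotDl hdotZl hv hw mulr0 addr0.
move: w aw; apply: (alg_ind sub) => a b w ww /=.
set k := a%:Z - b%:Z.
have orth : hdot (w Om) (x Om - e k Om) = 0.
  pose j := if 0 <= k then b else a.
  have rE : (rowlen k + j = a + n)%N by rewrite /rowlen /j; case: ifP; lia.
  have cE : (collen k + j = b + n)%N by rewrite /collen /j; case: ifP; lia.
  case: (eP k) => _ _ h; apply: (h j); rewrite rE cE; exact: wspan_up.
have off j : j != k -> hdot (w Om) (e j Om) = 0.
  move=> jk; rewrite adjE; last exact: (wspan_bounded hS ww).
  have sp : spec (- k + j) (adj w \o e j).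
    apply: spectral_comp; first exact/spectral_adj/wspan_spectral.
    by have := wspan_spectral (we j); rewrite len_degree.
  by apply: (spectral_state sp); rewrite addrC subr_eq0.
rewrite hdotBr sum_opE hdot_sumr.
have [kd|/e0 ek] := boolP (k \in degrees).
  rewrite (bigD1_seq k) ?uniq_degrees //= big1 => [|j]; last exact: off.
  by rewrite addr0 -hdotBr.
rewrite ek subr0 in orth; rewrite orth big1 ?subr0 // => j _.
by have [->|] := eqVneq j k; [rewrite ek hdot0r|exact: off].
Qed.

Lemma fixed_alg x : (0 < n)%N -> vnM S x -> theta x = x -> alg S x.
Proof.
move=> n0 Mx fx; have [e eP ->] := fixed_decomposition n0 Mx fx.
apply: subspace_sum => [|k _]; first exact: alg_subspace.
by case: (eP k) => we _; exact: wspan_alg we.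
Qed.


Lemma spectral_independent (s : seq int) (w : int -> H -> H) : uniq s ->
  (forall k, k \in s -> spec k (w k)) -> \sum_(k <- s) w k = 0 ->
  forall k, k \in s -> w k = 0.
Proof.
move=> us sw sum0 k ks; have [Mk _] := sw k ks.
apply: separating => //; first by case: (vnM_subspace hS).
apply: hdot_eq0.
have := congr1 (fun f : H -> H => hdot (w k Om) (f Om)) sum0.
rewrite sum_opE hdot_sumr (bigD1_seq k) //= hdot0r big_seq_cond.
rewrite big1 => [|j]; first by rewrite addr0.
case/andP=> js jk; rewrite adjE; last exact: (vnM_bounded Mk).
have sp : spec (- k + j) (adj (w k) \o w j).
  by apply: spectral_comp; [exact/spectral_adj/sw|exact: sw].
by apply: (spectral_state sp); rewrite addrC subr_eq0.
Qed.

Lemma fixed_direct_sum : (0 < n)%N ->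
  internal_direct_sum degrees (fun k => fixed (spec k) theta) (fixed (vnM S) theta).
Proof.
move=> n0; split; last first.
  by move=> w hw; apply: spectral_independent; [exact: uniq_degrees|move=> k /hw []].
apply/seteqP; split=> x.
  case=> Mx fx; have [e eP ->] := fixed_decomposition n0 Mx fx.
  exists e => // k _; have [we fe] := eP k; split=> //.
  by have := wspan_spectral we; rewrite len_degree.
case=> w hw ->; rewrite big_seq_cond.
have [M0 _] := vnM_subspace hS.
apply: (big_ind (fixed (vnM S) theta)) => [|y z [My fy] [Mz fz]|k].
- by split=> //; exact: theta0.
- split; first by apply: subspaceD My Mz; exact: vnM_subspace.
  by rewrite -[y]scale1r theta_lin fy fz.
- by rewrite andbT => /hw [[Mk _] fk].
Qed.

Lemma fixed_spectral0 : (0 < n)%N ->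
  fixed (vnM S) theta `&` spec 0 = fixed (wspan S n n) theta.
Proof.
move=> n0; apply/seteqP; split=> x; last first.
  case=> wx fx; split; first by split=> //; exact: wspan_vnM wx.
  by have := wspan_spectral wx; rewrite subrr.
case=> -[Mx fx] sx; have [e eP xE] := fixed_decomposition n0 Mx fx.
have d0 : 0 \in degrees by rewrite mem_degrees.
pose w k := e k - (if k == 0 then x else 0).
have w0 : w 0 = 0.
  apply: (@spectral_independent degrees) => //; first exact: uniq_degrees.
    move=> k _; apply: subspaceB; first exact: spectral_subspace.
      by have [we _] := eP k; have := wspan_spectral we; rewrite len_degree.
    by case: eqP => [->|_] //; case: (spectral_subspace k).
  rewrite /w sumrB -xE (bigD1_seq 0) ?uniq_degrees //= big1 ?addr0 ?subrr //.
  by move=> k /negPf ->.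
have [we _] := eP 0; rewrite /rowlen /collen lexx addn0 in we; split=> //.
by move/eqP: w0; rewrite /w eqxx subr_eq0 => /eqP <-.
Qed.

(** For the inclusion from right to left, a fixed point [x] of [theta] commutes
    with [g a] for all words [a], and lies in [alg S], so that right
    multiplication by [x] is an operator [T] of the commutant.  Then
    [x (g a) Om = T (g a) Om], and this passes to all [y] in place of [a]
    because [y Om |-> (g y) Om] is isometric. *)
Lemma commutant_fixed g : (0 < n)%N -> star_endomorphism (vnM S) g ->
  (forall x, vnM S x -> omega (g x) = omega x) -> (forall i, g (S i) = u \o S i) ->
  commutant (g @` vnM S) `&` vnM S = fixed (vnM S) theta.
Proof.
move=> n0 sg ginv gS; have bSi i := bounded_S hS i; have bSi' i := bounded_adj (bSi i).
apply/seteqP; split=> x.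
  case=> -[bx xc] Mx; split=> //.
  have xS i : x \o (u \o S i) = u \o S i \o x.
    by rewrite -gS; apply: xc; exists (S i) => //; exact: vnM_S.
  rewrite /theta /= /Ad /phi comp_sumr // comp_suml.
  rewrite -[RHS]/(x \o idfun) -uu' -[RHS]/(x \o u \o (idfun \o adj u)) -(sum_SadjS hS).
  rewrite comp_suml comp_sumr; last exact: bounded_comp.
  apply: eq_bigr => i _.
  by rewrite -[LHS]/((u \o S i \o x) \o (adj (S i) \o adj u)) -xS.
case=> Mx fx; have bx := vnM_bounded Mx; split=> //; split=> // _ [y My <-].
have ax := fixed_alg n0 Mx fx.
have fixS z i : bounded_op z -> theta z = z -> z \o (u \o S i) = u \o S i \o z.
  move=> bz fz; rewrite -{1}fz.
  rewrite -[LHS]/(u \o phi S z \o (adj u \o u) \o S i) u'u.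
  by rewrite -[LHS]/(u \o (phi S z \o S i)) phi_S.
have xS i : x \o g (S i) = g (S i) \o x by rewrite gS fixS.
have MS i : vnM S (S i) by exact: vnM_S.
have bgS i : bounded_op (g (S i)) by apply: vnM_bounded; exact: (endo_in sg).
have xS' i : x \o adj (g (S i)) = adj (g (S i)) \o x.
  have fx' : theta (adj x) = adj x by rewrite theta_adj // fx.
  have := fixS _ i (bounded_adj bx) fx'; rewrite -gS => /(congr1 adj).
  by rewrite (adj_comp (bounded_adj bx) (bgS i)) (adj_comp (bgS i) (bounded_adj bx)) (adjK bx).
have xg z : alg S z -> x \o g z = g z \o x.
  move=> az; suff [] : [set z : H -> H | vnM S z /\ x \o g z = g z \o x] z by [].
  have sub : subspace [set z : H -> H | vnM S z /\ x \o g z = g z \o x].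
    split; first by split; [case: (vnM_subspace hS)|rewrite (endo0 cM sg) comp0r].
    move=> a v w [Mv xv] [Mw xw]; split; first by case: (vnM_subspace hS) => _; exact.
    rewrite (endo_lin sg) // -[RHS]/(a *: (g v \o x) + (g w \o x)) -xv -xw.
    by apply/funext => xi; exact: op_lin.
  have mul v w : vnM S v /\ x \o g v = g v \o x -> vnM S w /\ x \o g w = g w \o x ->
      vnM S (v \o w) /\ x \o g (v \o w) = g (v \o w) \o x.
    move=> [Mv xv] [Mw xw]; split; first exact: vnM_mul.
    by rewrite (endo_comp sg) // -[LHS]/((x \o g v) \o g w) xv -[LHS]/(g v \o (x \o g w)) xw.
  move: z az; apply: (alg_ind sub) => l m; apply: (wspan_ind sub) => mu nu _ _ /=.
  apply: (mul).
    elim: mu => [|i mu IH]; first by split; [exact: vnM_id|rewrite (endo_id sg)].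
    exact: (mul (S i) (word S mu) (conj (MS i) (xS i)) IH).
  elim/last_ind: nu => [|nu i IH].
    by rewrite /= adj_id; split; [exact: vnM_id|rewrite (endo_id sg)].
  rewrite adj_word_rcons //; apply: (mul) => //; split; first exact: vnM_adj.
  by rewrite (endo_adj sg).
have Mgy : vnM S (g y) := endo_in sg My.
apply: separating; [exact: vnM_mul|exact: vnM_mul|].
have [T TC TE] := right_mult ax; have [bT _] := TC.
have gT z : vnM S z -> g z (x Om) = T (g z Om).
  move=> Mz; rewrite -TE; exact: (congr1 (@^~ Om) (vnM_commutant (endo_in sg Mz) TC)).
rewrite /= gT //; apply/eqP; rewrite -subr_eq0; apply/eqP/hn_eq0.
have bxT := boundedB bx bT; have /bounded_opP[_ [C C0 hC]] := bxT.
apply/le_anti; rewrite hn_ge0 andbT; apply: (le0_eps C0) => e e0.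
have [_ [z az <-] lz] := alg_dense_Om (y Om) e0.
have Mz := alg_vnM hS az.
have zero : (x - T) (g z Om) = 0.
  rewrite -[LHS]/(x (g z Om) - T (g z Om)) -gT //.
  by rewrite -[x (g z Om)]/((x \o g z) Om) xg // subrr.
rewrite -[X in hn X]/((x - T) (g y Om)) -[(x - T) _]subr0 -zero -opB //.
apply: le_trans (hC _) _; rewrite ler_wpM2l //.
rewrite -[g y Om - g z Om]/((g y - g z) Om) -(endoB sg) // (endo_isometry cM sg ginv).
  exact: ltW.
by apply: subspaceB My Mz; exact: vnM_subspace.
Qed.

End Theta.

(** * The endomorphisms lambda on words and shifts *)

Implicit Types (v : H -> H).

(** The product [v phi(v) ... phi^(k-1)(v)], by which [lam v] multiplies the
    words of length [k]. *)
Fixpoint cocycle (v : H -> H) (k : nat) : H -> H :=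
  if k is m.+1 then v \o phi S (cocycle v m) else idfun.

Lemma cocycle_bounded v k : bounded_op v -> bounded_op (cocycle v k).
Proof.
move=> bv; elim: k => [|k IH]; first exact: bounded_id.
by apply: bounded_comp => //; exact: bounded_phi.
Qed.

Lemma iter_phi_bounded v k : bounded_op v -> bounded_op (iter k (phi S) v).
Proof. by move=> bv; elim: k => [|k IH] //=; exact: bounded_phi. Qed.

Lemma iter_phi_adj v k : bounded_op v -> iter k (phi S) (adj v) = adj (iter k (phi S) v).
Proof.
by move=> bv; elim: k => [|k IH] //=; rewrite IH phi_adj //; exact: iter_phi_bounded.
Qed.

Lemma cocycleSr v k : bounded_op v ->
  cocycle v k.+1 = cocycle v k \o iter k (phi S) v.
Proof.
move=> bv; have bi := @bounded_id K H; elim: k => [|k IH]; first by rewrite /= phi_id.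
rewrite -[LHS]/(v \o phi S (cocycle v k.+1)) [in LHS]IH.
by rewrite (phi_comp hS (cocycle_bounded k bv) (iter_phi_bounded k bv)).
Qed.

Lemma adj_lprod v k : bounded_op v -> adj (lprod S v k) = cocycle (adj v) k.
Proof.
move=> bv; have bv' := bounded_adj bv.
have bl j : bounded_op (lprod S v j).
  elim: j => [|j IH]; first exact: bounded_id.
  by apply: bounded_comp => //; exact: iter_phi_bounded.
elim: k => [|k IH]; first exact: adj_id.
by rewrite cocycleSr // iter_phi_adj // -IH -adj_comp //; exact: iter_phi_bounded.
Qed.

Lemma phi_unitary v : unitary_op v -> unitary_op (phi S v).
Proof.
case=> bv v'v vv'; have bv' := bounded_adj bv; split; first exact: bounded_phi.
  by rewrite -phi_adj // -phi_comp // v'v phi_id.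
by rewrite -phi_adj // -phi_comp // vv' phi_id.
Qed.

Lemma comp_unitary v (w : H -> H) : unitary_op v -> unitary_op w -> unitary_op (v \o w).
Proof.
case=> bv v'v vv' [bw w'w ww']; split; first exact: bounded_comp.
  rewrite (adj_comp bv bw) -[LHS]/(adj w \o (adj v \o v) \o w) v'v; exact: w'w.
rewrite (adj_comp bv bw) -[LHS]/(v \o (w \o adj w) \o adj v) ww'; exact: vv'.
Qed.

Lemma lprod_unitary v k : unitary_op v -> unitary_op (lprod S v k).
Proof.
move=> uv; elim: k => [|k IH].
  by split; rewrite /= ?adj_id //; exact: bounded_id.
apply: comp_unitary => //; elim: k {IH} => [|k IH] //=; exact: phi_unitary.
Qed.

Lemma iter_phi_wspan l m x k : wspan S l m x -> wspan S (k + l) (k + m) (iter k (phi S) x).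
Proof. by move=> wx; elim: k => [|k IH] //=; rewrite !addSn; exact: wspan_phi. Qed.

Lemma lprod_wspan v k : wspan S 2 2 v -> wspan S k.+1 k.+1 (lprod S v k).
Proof.
move=> wv; elim: k => [|k IH]; first exact: wspan_id.
have := iter_phi_wspan k wv; rewrite addn2 => w; apply: (wspan_mul hS w).
by apply: wspan_succ.
Qed.

(** Because [phi^m(b) S_mu = S_mu b] for every word [mu] of length [m]. *)
Lemma wspan_iter_phi m x b : bounded_op b -> wspan S m m x ->
  x \o iter m (phi S) b = iter m (phi S) b \o x.
Proof.
move=> bb; have bi k := iter_phi_bounded k bb.
have ww mu : iter (size mu) (phi S) b \o word S mu = word S mu \o b.
  elim: mu => [//|i mu IH] /=.
  rewrite -[LHS]/((phi S (iter (size mu) (phi S) b) \o S i) \o word S mu) phi_S //.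
  exact: (congr1 (fun f : H -> H => S i \o f) IH).
have wa mu : adj (word S mu) \o iter (size mu) (phi S) b = b \o adj (word S mu).
  elim: mu => [|i mu IH]; first by rewrite /= adj_id.
  rewrite adj_word_cons //.
  rewrite -[LHS]/(adj (word S mu) \o (adj (S i) \o phi S (iter (size mu) (phi S) b))).
  by rewrite adjS_phi // -[RHS]/((b \o adj (word S mu)) \o adj (S i)) -IH.
have sub : subspace [set x : H -> H | x \o iter m (phi S) b = iter m (phi S) b \o x].
  split; first by rewrite /= comp0r.
  move=> a y z /= hy hz; rewrite -[LHS]/(a *: (y \o iter m (phi S) b) + (z \o iter m (phi S) b)).
  by rewrite hy hz; apply/funext => xi; apply/esym; exact: op_lin.
apply: (wspan_ind sub) => mu nu smu snu /=.
rewrite -[LHS]/(word S mu \o (adj (word S nu) \o iter m (phi S) b)) -{1}snu wa.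
by rewrite -[RHS]/((iter m (phi S) b \o word S mu) \o adj (word S nu)) -smu ww.
Qed.

Section Lambda.
Context (v : H -> H).
Hypotheses (uv : unitary_op v) (Fv : Falg S v).

Let bv : bounded_op v. Proof. by case: uv. Qed.
Let Mv : vnM S v. Proof. exact: (cuntz_vnM hS (Falg_cuntz hS Fv)). Qed.

Lemma lam_endo : star_endomorphism (vnM S) (lam v).
Proof. by case: (hlam uv Fv). Qed.

Lemma lam_state x : vnM S x -> omega (lam v x) = omega x.
Proof. by case: (hlam uv Fv) => _ _ _ h _; exact: h. Qed.

Lemma lam_S i : lam v (S i) = v \o S i.
Proof. by case: (hlam uv Fv). Qed.

Let MS i : vnM S (S i) := vnM_S hS i.

Lemma lam_word mu : lam v (word S mu) = cocycle v (size mu) \o word S mu.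
Proof.
elim: mu => [|i mu IH]; first exact: (endo_id lam_endo).
have Mw : vnM S (word S mu) := alg_vnM hS (alg_word S mu).
rewrite (endo_comp lam_endo (MS i) Mw) lam_S IH.
rewrite -[RHS]/(v \o (phi S (cocycle v (size mu)) \o S i) \o word S mu) phi_S //.
exact: cocycle_bounded.
Qed.

Lemma lam_wspan k x : wspan S k k x -> lam v x = cocycle v k \o x \o adj (cocycle v k).
Proof.
have bc := cocycle_bounded k bv; have bc' := bounded_adj bc.
suff h : wspan S k k `<=` [set x | vnM S x /\ lam v x = cocycle v k \o x \o adj (cocycle v k)].
  by move=> /h[].
apply: wspan_ind.
  split.
    split; first by case: (vnM_subspace hS).
    by rewrite (endo0 (vnM_cstar hS) lam_endo) comp0r.
  move=> a y z [My hy] [Mz hz]; split; first by case: (vnM_subspace hS) => _; exact.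
  rewrite (endo_lin lam_endo) // hy hz; apply/funext => xi.
  by apply/esym; exact: op_lin.
move=> mu nu smu snu; have Mw al : vnM S (word S al) := alg_vnM hS (alg_word S al).
have bw := bounded_word hS nu.
split; first by apply: vnM_mul => //; exact: vnM_adj.
rewrite (endo_comp lam_endo (Mw mu) (vnM_adj hS (Mw nu))) (endo_adj lam_endo (Mw nu)).
by rewrite !lam_word smu snu (adj_comp bc bw).
Qed.

Lemma lam_phi x : vnM S x -> lam v (phi S x) = v \o phi S (lam v x) \o adj v.
Proof.
move=> Mx; have MSx i : vnM S (S i \o x) by exact: vnM_mul.
have MS' i : vnM S (adj (S i)) by exact: vnM_adj.
rewrite [phi S x]/phi (endo_sum (vnM_cstar hS) lam_endo) => [|i _]; last exact: vnM_mul.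
rewrite [in RHS]/phi comp_sumr // comp_suml; apply: eq_bigr => i _.
rewrite (endo_comp lam_endo (MSx i) (MS' i)) (endo_comp lam_endo (MS i) Mx).
by rewrite (endo_adj lam_endo (MS i)) lam_S (adj_comp bv (bounded_S hS i)).
Qed.

Lemma lam_iter_endo k : star_endomorphism (vnM S) (iter k (lam v)).
Proof.
elim: k => [|k IH]; first by split.
have sv := lam_endo; have Mk x : vnM S x -> vnM S (iter k (lam v) x) by exact: (endo_in IH).
split=> [x Mx||a x y Mx My|x y Mx My|x Mx] /=.
- exact: (endo_in sv (Mk x Mx)).
- by rewrite (endo_id IH) (endo_id sv).
- by rewrite (endo_lin IH) // (endo_lin sv) //; exact: Mk.
- by rewrite (endo_comp IH) // (endo_comp sv) //; exact: Mk.
- by rewrite (endo_adj IH) // (endo_adj sv) //; exact: Mk.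
Qed.

Lemma lam_iter_state k x : vnM S x -> omega (iter k (lam v) x) = omega x.
Proof.
move=> Mx; elim: k => [//|k IH]; rewrite iterS lam_state //.
exact: (endo_in (lam_iter_endo k) Mx).
Qed.

End Lambda.

Section Braid.
Context (r : H -> H).
Hypotheses (ur : unitary_op r) (wr : wspan S 2 2 r).
Hypothesis braid : r \o phi S r \o r = phi S r \o r \o phi S r.

Let br : bounded_op r. Proof. by case: ur. Qed.
Let Fr : Falg S r. Proof. exact: wspan_Falg wr. Qed.
Let Mr : vnM S r. Proof. exact: wspan_vnM wr. Qed.

Let M_iter k : vnM S (iter k (phi S) r).
Proof. by elim: k => [|k IH] //=; exact: vnM_phi. Qed.

(** By the braid relation [r phi(r) r (r phi(r))^* = phi(r)]; the shifts follow
    since [r] commutes with the range of [phi^2]. *)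
Lemma lam_iter_phi k : lam r (iter k (phi S) r) = iter k.+1 (phi S) r.
Proof.
case: ur => _ r'r rr'; have [bp _ pp'] := phi_unitary ur.
elim: k => [|k IH].
  have c2 : cocycle r 2 = r \o phi S r by rewrite /= phi_id.
  rewrite [iter 0 _ _]/= (lam_wspan ur Fr wr) c2.
  rewrite -[(r \o phi S r) \o r]/(r \o phi S r \o r) braid (adj_comp br bp).
  rewrite -[LHS]/(phi S r \o (r \o (phi S r \o adj (phi S r)) \o adj r)) pp'.
  by rewrite -[(r \o idfun) \o adj r]/(r \o adj r) rr'.
rewrite iterS (lam_phi ur Fr (M_iter k)) IH.
have := wspan_iter_phi (iter_phi_bounded k br) wr; rewrite /= => ->.
by rewrite -[LHS]/(phi S (phi S (iter k (phi S) r)) \o (r \o adj r)) rr'.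
Qed.

Let M_lprod k : vnM S (lprod S r k).
Proof. exact: wspan_vnM (lprod_wspan k wr). Qed.

Lemma lam_lprod k : lam r (lprod S r k) \o r = lprod S r k.+1.
Proof.
elim: k => [|k IH]; first by rewrite /= (endo_id (lam_endo ur Fr)).
rewrite [lprod S r k.+1]/= (endo_comp (lam_endo ur Fr)) // lam_iter_phi.
by rewrite -[LHS]/(iter k.+1 (phi S) r \o (lam r (lprod S r k) \o r)) IH.
Qed.

Lemma lam_iter_S k i : iter k (lam r) (S i) = lprod S r k \o S i.
Proof.
elim: k => [//|k IH]; rewrite iterS IH (endo_comp (lam_endo ur Fr)) //; last exact: vnM_S.
by rewrite (lam_S ur Fr) -[LHS]/((lam r (lprod S r k) \o r) \o S i) lam_lprod.
Qed.

End Braid.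

(** * The relative commutants *)

Section Main.
Context (r : H -> H) (n : nat).
Hypotheses (hd2 : (1 < d)%N) (n0 : (0 < n)%N).
Hypotheses (ur : unitary_op r) (wr : wspan S 2 2 r).
Hypothesis braid : r \o phi S r \o r = phi S r \o r \o phi S r.
Let u := lprod S r n.
Let theta := Ad u \o phi S.

Let Fr : Falg S r. Proof. exact: wspan_Falg wr. Qed.
Let uu : unitary_op u. Proof. exact: lprod_unitary. Qed.
Let wu : wspan S n.+1 n.+1 u. Proof. exact: lprod_wspan. Qed.

Lemma relcomm_fixed : relcomm S lam r n = fixed (vnM S) theta.
Proof.
apply: (commutant_fixed hd2 uu wu n0 (lam_iter_endo ur Fr n)).
  by move=> x Mx; exact: lam_iter_state.
by move=> i; exact: lam_iter_S.
Qed.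

Lemma relcomm_direct_sum :
  internal_direct_sum (degrees n) (fun k => fixed (spec k) theta) (relcomm S lam r n).
Proof. by rewrite relcomm_fixed; exact: fixed_direct_sum. Qed.

Lemma relcomm0_fixed : relcomm0 S lam r n = fixed (wspan S n n) theta.
Proof. by rewrite /relcomm0 relcomm_fixed; exact: fixed_spectral0. Qed.

Lemma relcomm0_vnN :
  relcomm0 S lam r n = commutant (iter n (lam r) @` vnM S) `&` vnN S.
Proof.
apply/seteqP; split=> x.
  move=> rx; have : relcomm0 S lam r n x by []. 
  rewrite relcomm0_fixed => -[wx _]; case: rx => -[cx _] _; split=> //.
  exact: (wspan_vnN hS wx).
case=> cx Nx; split; last exact: vnN_spectral0.
by split=> //; exact: vnN_vnM.
Qed.

Lemma relcomm0_conj :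
  relcomm0 S lam r n = [set x | wspan S n n x /\ phi S x = adj u \o x \o u].
Proof.
have [bu u'u uu'] := uu.
rewrite relcomm0_fixed; apply/seteqP; split=> x [wx fx]; split=> //.
  rewrite -{2}fx /theta /= /Ad.
  by rewrite -[RHS]/((adj u \o u) \o phi S x \o (adj u \o u)) u'u.
rewrite /theta /= /Ad fx.
by rewrite -[LHS]/((u \o adj u) \o x \o (u \o adj u)) uu'.
Qed.

Lemma relcomm0_lam :
  relcomm0 S lam r n = [set x | wspan S n n x /\ phi S x = lam (adj r) x].
Proof.
have [br r'r rr'] := ur; have ur' : unitary_op (adj r).
  by split; rewrite ?adjK //; exact: bounded_adj.
have Fr' : Falg S (adj r) by exact: (wspan_Falg hS (wspan_adj hS wr)).
have [bu _ _] := uu.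
have lamE x : wspan S n n x -> lam (adj r) x = adj u \o x \o u.
  by move=> wx; rewrite (lam_wspan ur' Fr' wx) -adj_lprod // adjK.
by rewrite relcomm0_conj; apply/seteqP; split=> x [wx fx]; split=> //; rewrite fx lamE.
Qed.

End Main.

End CuntzState.

Theorem proposition3p1 (K : realType) (H : hilbertSpace K) (d : nat)
    (S : 'I_d -> H -> H) (tau : (H -> H) -> K[i]) (Om : H)
    (lam : (H -> H) -> (H -> H) -> (H -> H))
    (R : 'M[K[i]]_(d * d)) (n : nat) :
  (2 <= d)%N ->
  cuntz_family S ->
  normalized_trace S tau ->
  (forall u : H -> H, unitary_op u -> Falg S u ->
     lambda_extension S Om u (lam u)) ->
  gns_vector S lam tau Om ->
  R_matrix R ->
  (1 <= n)%N ->
  let r : H -> H := embed2 S R in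
  let theta : (H -> H) -> (H -> H) := Ad (lprod S r n) \o phi S in
  [/\ relcomm S lam r n = fixed (vnM S) theta
      /\ internal_direct_sum [seq - n%:Z + i%:Z | i <- index_iota 1 (2 * n)]
           (fun k => fixed (spectral S lam k) theta) (relcomm S lam r n),
      [/\ relcomm0 S lam r n = commutant (iter n (lam r) @` vnM S) `&` vnN S,
          relcomm0 S lam r n = fixed (Fn S n) theta &
          relcomm0 S lam r n = [set x | Fn S n x /\ phi S x = lam (adj r) x]] &
      relcomm S lam r 1 = relcomm0 S lam r 1
      /\ relcomm S lam r 1 = [set x | Fn S 1 x /\ phi S x = adj r \o x \o r]].

Proof.
move=> hd2 hS htau hlam hgns hR n0 r theta.
have hd : (0 < d)%N := ltnW hd2.
have ur : unitary_op r by apply: embed2_unitary => //; case: hR.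
have wr : wspan S 2 2 r := embed2_wspan S R.
have braid := embed2_braid hS hR.
have lprod1 : lprod S r 1 = r by [].
split; first split.
- exact: (relcomm_fixed hd hS htau hlam hgns hd2 n0 ur wr braid).
- exact: (relcomm_direct_sum hd hS htau hlam hgns hd2 n0 ur wr braid).
- split.
  + exact: (relcomm0_vnN hd hS htau hlam hgns hd2 n0 ur wr braid).
  + exact: (relcomm0_fixed hd hS htau hlam hgns hd2 n0 ur wr braid).
  + exact: (relcomm0_lam hd hS htau hlam hgns hd2 n0 ur wr braid).
have E0 : relcomm S lam r 1 = relcomm0 S lam r 1.
  have [E _] := relcomm_direct_sum hd hS htau hlam hgns hd2 (ltn0Sn 0) ur wr braid.
  apply/seteqP; split=> x; last by case.
  move=> rx; split=> //; move: rx; rewrite E => -[w hw ->].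
  by rewrite /degrees /= big_seq1; case: (hw 0 (mem_head _ _)).
split=> //; rewrite E0.
by rewrite (relcomm0_conj hd hS htau hlam hgns hd2 (ltn0Sn 0) ur wr braid) lprod1.
Qed.
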